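(* Let $\mathfrak{c}\in L^\#$ with $Q(\mathfrak{c})\in\mathbb{Z}$, let $c=(1,0,\mathfrak{c},0,Q(\mathfrak{c}))^{tr}\in\mathbb{Q}^{n+4}$, and let $k>n+2$. Then for all $z\in\mathbb{H}_S$ $$E_{k,S,c}(z)=\frac12\sum_{\substack{g\in L_1+c\\ \gcd(S_1g)=1\\ Q_1(g)=0}} j(g,z)^{-k},$$ where for $g=(\delta,d,\gamma)^{tr}$ with $\delta,\gamma\in\mathbb{Q}$, $d\in\mathbb{Q}^{n+2}$ one sets $j(g,z)=-\gamma Q_0(z)+(d,z)_0+\delta$. Moreover $E_{k,S,c}$ is a modular form of weight $k$ for $\widetilde{\Gamma}_S$.
   Context: Let $n\ge1$, $S\in\mathbb{Z}^{n\times n}$ symmetric positive definite with even diagonal, $L=\mathbb{Z}^n$, $Q(v)=\frac12v^{tr}Sv$, $L^\#=S^{-1}\mathbb{Z}^n$. Let $S_0=\begin{pmatrix}0&0&1\\0&-S&0\\1&0&0\end{pmatrix}$, $(u,v)_0=u^{tr}S_0v$ (extended $\mathbb{C}$-bilinearly), $Q_0(v)=\frac12(v,v)_0$; $S_1=\begin{pmatrix}0&0&1\\0&S_0&0\\1&0&0\end{pmatrix}$, $L_1=\mathbb{Z}^{n+4}$, $Q_1(v)=\frac12v^{tr}S_1v$. For a vector $v$ with integral entries $\gcd(v)$ is the gcd of the entries. $O^+(S_1;\mathbb{R})$ is the identity component of $\{M\in\mathbb{R}^{(n+4)\times(n+4)}: M^{tr}S_1M=S_1\}$, $\Gamma_S=O^+(S_1;\mathbb{Z})$,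 and the discriminant kernel is $\widetilde\Gamma_S=\{M\in\Gamma_S: M\in I+\mathbb{Z}^{(n+4)\times(n+4)}S_1\}$. Writing $M=\begin{pmatrix}\alpha&a^{tr}S_0&\beta\\ b&K&c'\\ \gamma&d^{tr}S_0&\delta\end{pmatrix}$, $M$ acts on $\mathbb{H}_S=\{x+iy\in\mathbb{C}^{n+2}: Q_0(y)>0,y_1>0\}$ by $M\langle z\rangle=(-Q_0(z)b+Kz+c')j(M,z)^{-1}$, $j(M,z)=-\gamma Q_0(z)+(d,z)_0+\delta$. A modular form of weight $k$ for $\Gamma$ is a holomorphic $f$ on $\mathbb{H}_S$ with $j(M,z)^{-k}f(M\langle z\rangle)=f(z)$ for all $M\in\Gamma$. With $\tilde c=(0,\mathfrak c,0)^{tr}\in\mathbb{Q}^{n+2}$, let $\widetilde T_c=\begin{pmatrix}1&0&0\\ \tilde c&I&0\\ Q(\mathfrak c)&-\tilde c^{tr}S_0&1\end{pmatrix}$ (so $\widetilde T_ce_1=c$, $e_1=(1,0,\dots,0)^{tr}$). Let $\widetilde\Gamma_{S,c}=\{M\in\widetilde\Gamma_S: Mc=c\}$. For $k>n+2$ the Eisenstein series is $E_{k,S,c}(z)=\frac12\sum_{M\in\widetilde\Gamma_{S,c}\backslash\widetilde\Gamma_S}j(\widetilde T_c^{-1}M,z)^{-k}$ (absolutely convergent). *)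

(* Defs.v *)
From HB Require Import structures.
From mathcomp Require Import all_boot all_order all_algebra.
From mathcomp Require Import all_classical all_reals all_analysis.
From mathcomp Require Import complex.
From mathcomp.analysis.showcase Require summability.

Set Implicit Arguments.
Unset Strict Implicit.
Unset Printing Implicit Defensive.

Import Order.TTheory GRing.Theory Num.Theory.
Import numFieldNormedType.Exports.

Local Open Scope classical_set_scope.
Local Open Scope ring_scope.

(* The topology and normed structure on numerical fields are attached to the
   structure types, so [R[i]] has to be seen as a [numClosedFieldType]. *)
Definition Cx (R : realType) : numClosedFieldType := R[i].

(* Complex (Frechet) differentiability at every point; the sets [D] of interest
   are open, and the values of [f] outside [D] are otherwise irrelevant. *)
Definition holomorphic_on (R : realType) m (D : set 'cV[R[i]]_m)
    (f : 'cV[R[i]]_m -> R[i]) : Prop :=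
  forall z, D z -> differentiable (f : 'cV[Cx R]_m -> Cx R) (z : 'cV[Cx R]_m).

Definition abs_summable (R : realType) (I : choiceType) (D : set I)
    (f : I -> R[i]) : Prop :=
  summable D (fun i => (Normc.normc (f i))%:E).

(* The limit of the finite partial sums along the directed set of all finite
   sets of indices; meaningful when [abs_summable D f]. *)
Definition csum (R : realType) (I : choiceType) (D : set I)
    (f : I -> R[i]) : R[i] :=
  @summability.sum I (Cx R) (Cx R) (fun i => if i \in D then f i else 0).

Notation bil A u v := ((u^T *m A *m v) 0 0).

Definition qform (F : fieldType) m (A : 'M[F]_m) (v : 'cV[F]_m) : F :=
  2^-1 * bil A v v.

Definition hyp_ext (T : pzRingType) m (A : 'M[T]_m) : 'M[T]_(1 + (m + 1)) :=
  block_mx 0              (row_mx 0 1%:M)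
           (col_mx 0 1%:M) (block_mx A 0 0 0).

Notation dim0 n := (1 + (n + 1))%N.
Notation dim1 n := (1 + (dim0 n + 1))%N.

Definition S0 n (S : 'M[int]_n) : 'M[int]_(dim0 n) := hyp_ext (- S).
Definition S1 n (S : 'M[int]_n) : 'M[int]_(dim1 n) := hyp_ext (S0 S).

Definition inF (F : pzRingType) m p (A : 'M[int]_(m, p)) : 'M[F]_(m, p) :=
  map_mx intr A.

Definition even_posdef (R : realType) n (S : 'M[int]_n) : Prop :=
  [/\ S^T = S,
      forall i, (2 %| S i i)%Z
    & forall x : 'cV[R]_n, x != 0 -> 0 < bil (inF R S) x x].

Definition dual_lattice n (S : 'M[int]_n) : set 'cV[rat]_n :=
  [set invmx (inF rat S) *m inF rat v | v in [set: 'cV[int]_n]].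

(* On a vector with integral entries, [numq] is the entry itself. *)
Definition vgcd m (v : 'cV[rat]_m) : nat :=
  \big[gcdn/0%N]_i absz (numq (v i 0)).

Definition orthoR (R : realType) n (S : 'M[int]_n) : set 'M[R]_(dim1 n) :=
  [set M | M^T *m inF R (S1 S) *m M = inF R (S1 S)].

Definition orthoR_plus (R : realType) n (S : 'M[int]_n)
    : set 'M[R]_(dim1 n) :=
  connected_component (orthoR S) 1%:M.

Definition Gamma (R : realType) n (S : 'M[int]_n) : set 'M[int]_(dim1 n) :=
  [set M | orthoR_plus S (inF R M)].

Definition disc_kernel (R : realType) n (S : 'M[int]_n)
    : set 'M[int]_(dim1 n) :=
  [set M | Gamma R S M /\
           exists X : 'M[int]_(dim1 n), M = 1%:M + X *m S1 S].

Definition half_space (R : realType) n (S : 'M[int]_n)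
    : set 'cV[R[i]]_(dim0 n) :=
  [set z | let y : 'cV[R]_(dim0 n) := map_mx (@complex.Im R) z in
           0 < qform (inF R (S0 S)) y /\ 0 < (usubmx y) 0 0].

Definition Q0 (R : realType) n (S : 'M[int]_n) (z : 'cV[R[i]]_(dim0 n))
    : R[i] :=
  qform (inF R[i] (S0 S)) z.

(* With M = (alpha, a^T S0, beta; b, K, c'; gamma, d^T S0, delta), the middle
   block of the last row is [d^T S0], so that (d, z)_0 = (d^T S0) z. *)
Definition jM (R : realType) n (S : 'M[int]_n) (M : 'M[R[i]]_(dim1 n))
    (z : 'cV[R[i]]_(dim0 n)) : R[i] :=
  let gamma := (dsubmx (dlsubmx M)) 0 0 in
  let dS0 : 'rV[R[i]]_(dim0 n) := dlsubmx (drsubmx M) in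
  let delta := (drsubmx (drsubmx M)) 0 0 in
  - gamma * Q0 S z + (dS0 *m z) 0 0 + delta.

Definition act (R : realType) n (S : 'M[int]_n) (M : 'M[R[i]]_(dim1 n))
    (z : 'cV[R[i]]_(dim0 n)) : 'cV[R[i]]_(dim0 n) :=
  let b : 'cV[R[i]]_(dim0 n) := usubmx (dlsubmx M) in
  let K : 'M[R[i]]_(dim0 n) := ulsubmx (drsubmx M) in
  let c' : 'cV[R[i]]_(dim0 n) := ursubmx (drsubmx M) in
  (jM S M z)^-1 *: (- Q0 S z *: b + K *m z + c').

(* g = (delta, d, gamma)^T *)
Definition jvec (R : realType) n (S : 'M[int]_n) (g : 'cV[rat]_(dim1 n))
    (z : 'cV[R[i]]_(dim0 n)) : R[i] :=
  let delta := (usubmx g) 0 0 in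
  let d : 'cV[rat]_(dim0 n) := usubmx (dsubmx g) in
  let gamma := (dsubmx (dsubmx g)) 0 0 in
  - ratr gamma * Q0 S z + bil (inF R[i] (S0 S)) (map_mx ratr d) z
  + ratr delta.

Definition modular_form (R : realType) n (S : 'M[int]_n) (k : nat)
    (G : set 'M[int]_(dim1 n)) (f : 'cV[R[i]]_(dim0 n) -> R[i]) : Prop :=
  holomorphic_on (half_space S) f /\
  (forall M, G M -> forall z, half_space S z ->
     jM S (inF R[i] M) z ^- k * f (act S (inF R[i] M) z) = f z).

Definition ctilde n (c0 : 'cV[rat]_n) : 'cV[rat]_(dim0 n) :=
  col_mx 0 (col_mx c0 0).

Definition cusp_vec n (S : 'M[int]_n) (c0 : 'cV[rat]_n) : 'cV[rat]_(dim1 n) :=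
  col_mx 1%:M (col_mx (ctilde c0) (qform (inF rat S) c0)%:M).

Definition Ttilde n (S : 'M[int]_n) (c0 : 'cV[rat]_n) : 'M[rat]_(dim1 n) :=
  block_mx 1%:M 0
    (col_mx (ctilde c0) (qform (inF rat S) c0)%:M)
    (block_mx 1%:M 0 (- ((ctilde c0)^T *m inF rat (S0 S))) 1%:M).

Definition disc_stab (R : realType) n (S : 'M[int]_n) (c0 : 'cV[rat]_n)
    : set 'M[int]_(dim1 n) :=
  [set M | disc_kernel R S M /\
           inF rat M *m cusp_vec S c0 = cusp_vec S c0].

Definition cosets (R : realType) n (S : 'M[int]_n) (c0 : 'cV[rat]_n)
    : set (set 'M[int]_(dim1 n)) :=
  [set [set N *m M | N in disc_stab R S c0] | M in disc_kernel R S].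

(* The summand depends only on the coset [A]; it is evaluated at a chosen
   representative. *)
Definition eis_term (R : realType) n (S : 'M[int]_n) (c0 : 'cV[rat]_n)
    (k : nat) (z : 'cV[R[i]]_(dim0 n)) (A : set 'M[int]_(dim1 n)) : R[i] :=
  let M := xget 1%:M A in
  jM S (map_mx ratr (invmx (Ttilde S c0) *m inF rat M)) z ^- k.

Definition eisenstein (R : realType) n (S : 'M[int]_n) (c0 : 'cV[rat]_n)
    (k : nat) (z : 'cV[R[i]]_(dim0 n)) : R[i] :=
  2^-1 * csum (cosets R S c0) (eis_term S c0 k z).
Arguments eisenstein R [n] S c0 k z.

Definition prim_isotropic n (S : 'M[int]_n) (c0 : 'cV[rat]_n)
    : set 'cV[rat]_(dim1 n) :=
  [set g | [/\ exists l : 'cV[int]_(dim1 n), g = inF rat l + cusp_vec S c0,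
               vgcd (inF rat (S1 S) *m g) = 1%N
             & qform (inF rat (S1 S)) g = 0]].

(* Main.v *)
(** The map sending the coset of [M] to [M^-1 c] identifies the index set of the
    Eisenstein series with the orbit of [c] under the discriminant kernel, and turns
    [j(T_c^-1 M, z)] into [j(M^-1 c, z)]. By Eichler's criterion, which rests on the two
    hyperbolic planes split off by [S_1] and on Eichler transformations, this orbit
    consists of all isotropic [g] in [L_1 + c] with [gcd(S_1 g) = 1].

    For isotropic real [g] and fixed [z] the entries of [g] are bounded by a multiple of
    [|j(g, z)|], since [j(g, z)] is the product of [g] with a vector spanning a positive
    definite plane. Absolute convergence then follows from that of the sum of
    [|g|^-(n+3)] over the isotropic integral vectors, and the same bound gives
    holomorphy. Invariance is the cocycle relation
    [j(g, M<z>) j(M, z) = j(M^-1 g, z)] followed by a reindexing. *)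

From HB Require Import structures.
Require Import Defs.
From mathcomp Require Import all_boot all_order all_algebra.
From mathcomp Require Import all_classical all_reals all_analysis.
From mathcomp Require Import complex ring lra zify.
From mathcomp.analysis.showcase Require summability.

Set Implicit Arguments.
Unset Strict Implicit.
Unset Printing Implicit Defensive.

Import Order.TTheory GRing.Theory Num.Theory.
Import numFieldNormedType.Exports.

Local Open Scope classical_set_scope.
Local Open Scope ring_scope.

(** The obstacle is the range of k: it may be as small as n + 3, whereas a sum over all integral
    vectors in rank n + 4 needs an exponent above n + 4. Isotropy therefore has to save two
    dimensions, and a bound on the size of g cannot do this. The two hyperbolic planes give a
    parametrization that does: in 2 (a d + b c) = q(v), dividing a and b by their gcd fixes c modulo
    one of the quotients, and then d is forced. The vectors g need not be integral; multiplication
    by det S makes them so at the cost of a constant. The lower bound for |j(g, z)| does more than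
    give convergence. The derivative of j(g, .) at z is itself at most a multiple of |j(g, z)|, so
    j(g, z + h) / j(g, z) is close to 1 uniformly in g, and termwise expansion loses no summability.
    Infinite sums are handled only through bounds on finite sums, linearity and bijections of index
    sets; [csum] is reached through [has_sum_csum] alone. *)

Local Notation nrm := Normc.normc.

(** * Sums over arbitrary index sets *)

Section ComplexModulus.
Context (R : realType).
Implicit Types x y : R[i].

Lemma normr_nrm x : `|x| = (nrm x)%:C%C. Proof. by rewrite normc_def; case: x. Qed.

Lemma nrm_ge0 x : 0 <= nrm x. Proof. by case: x => a b; rewrite sqrtr_ge0. Qed.

Lemma nrm_eq0 x : (nrm x == 0) = (x == 0).
Proof. by rewrite -(inj_eq (@complexI R)) -normr_nrm normr_eq0. Qed.

Lemma nrmM x y : nrm (x * y) = nrm x * nrm y. Proof. exact: Normc.normcM. Qed.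

Lemma nrmV x : nrm x^-1 = (nrm x)^-1. Proof. exact: Normc.normcV. Qed.

Lemma nrmX x m : nrm (x ^+ m) = nrm x ^+ m.
Proof. by elim: m => [|m IH]; rewrite ?expr0 ?Normc.normc1// !exprS nrmM IH. Qed.

Lemma nrmN x : nrm (- x) = nrm x. Proof. exact: (@normcN R x). Qed.

Lemma nrmD x y : nrm (x + y) <= nrm x + nrm y. Proof. exact: (@le_normcD R x y). Qed.

Lemma nrmR (r : R) : nrm (r%:C%C : R[i]) = `|r|.
Proof. by rewrite /nrm /= expr0n/= addr0 sqrtr_sqr. Qed.

Lemma nrm0 : nrm (0 : R[i]) = 0. Proof. exact: Normc.normc0. Qed.

Lemma nrm_sum (I : Type) (s : seq I) (P : pred I) (F : I -> R[i]) :
  nrm (\sum_(i <- s | P i) F i) <= \sum_(i <- s | P i) nrm (F i).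
Proof.
elim/big_rec2: _ => [|i y1 y2 _ h]; first by rewrite nrm0.
by apply: le_trans (nrmD _ _) _; rewrite lerD2l.
Qed.

Lemma sqr_nrm x : nrm x ^+ 2 = complex.Re x ^+ 2 + complex.Im x ^+ 2.
Proof. by case: x => a b; rewrite /nrm /= sqr_sqrtr ?addr_ge0 ?sqr_ge0. Qed.

Lemma normRe_le x : `|complex.Re x| <= nrm x.
Proof.
rewrite -(@ler_pXn2r _ 2) ?nnegrE ?nrm_ge0// sqr_nrm real_normK ?num_real//.
by rewrite lerDl sqr_ge0.
Qed.

Lemma normIm_le x : `|complex.Im x| <= nrm x.
Proof.
rewrite -(@ler_pXn2r _ 2) ?nnegrE ?nrm_ge0// sqr_nrm real_normK ?num_real//.
by rewrite lerDr sqr_ge0.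
Qed.

End ComplexModulus.

(* All sums over possibly infinite index sets are handled through their finite
   parts: duplicate-free sequences of indices. *)
Definition sum_le (R : realType) (I : choiceType) (D : set I) (f : I -> R) (C : R) : Prop :=
  forall s : seq I, uniq s -> (forall i, i \in s -> D i) -> \sum_(i <- s) f i <= C.

Section BoundedSums.
Context (R : realType).

Lemma ler_sum_subset (I : choiceType) (f : I -> R) (s t : seq I) :
  uniq s -> uniq t -> {subset s <= t} -> (forall i, i \in t -> 0 <= f i) ->
  \sum_(i <- s) f i <= \sum_(i <- t) f i.
Proof.
move=> us ut st f0.
rewrite [leRHS](bigID [in s])/= -[X in _ <= X + _]big_filter.
rewrite [leLHS](perm_big [seq i <- t | i \in s]); last first.
  apply: uniq_perm; rewrite ?filter_uniq// => x; rewrite mem_filter.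
  by case: (boolP (x \in s)) => // /st ->.
by rewrite lerDl big_seq_cond sumr_ge0// => i /andP[/f0].
Qed.

Lemma sum_le_mono (I : choiceType) (D : set I) (f g : I -> R) C :
  (forall i, D i -> f i <= g i) -> sum_le D g C -> sum_le D f C.
Proof.
move=> fg H s us sD; apply: le_trans (H s us sD).
by rewrite big_seq [leRHS]big_seq ler_sum// => i /sD/fg.
Qed.

Lemma sum_leZ (I : choiceType) (D : set I) (f : I -> R) a C :
  0 <= a -> sum_le D f C -> sum_le D (fun i => a * f i) (a * C).
Proof. by move=> a0 H s us sD; rewrite -mulr_sumr ler_wpM2l// H. Qed.

Lemma sum_leU (I : choiceType) (D D1 D2 : set I) (f : I -> R) C1 C2 :
  D `<=` D1 `|` D2 -> (forall i, D i -> 0 <= f i) ->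
  sum_le (D `&` D1) f C1 -> sum_le (D `&` D2) f C2 -> sum_le D f (C1 + C2).
Proof.
move=> DD f0 H1 H2 s us sD.
rewrite (bigID (fun i => i \in D1))/= -big_filter -[X in _ + X]big_filter.
apply: lerD; [apply: H1|apply: H2]; rewrite ?filter_uniq// => i; rewrite mem_filter.
  by case/andP=> /set_mem iD /sD.
case/andP=> /negP iD /sD Di; split=> //.
by case: (DD i Di) => // /mem_set.
Qed.

Lemma sum_le_inj (I J : choiceType) (D : set I) (D' : set J) (phi : I -> J) (f : J -> R) C :
  set_inj D phi -> (forall i, D i -> D' (phi i)) ->
  sum_le D' f C -> sum_le D (f \o phi) C.
Proof.
move=> inj DD H s us sD; rewrite -[X in X <= _](big_map phi xpredT f); apply: H.
  rewrite map_inj_in_uniq// => x y /sD xD /sD yD; apply: inj; exact/mem_set.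
by move=> j /mapP[i /sD iD ->]; exact: DD.
Qed.

(** Tonelli for nonnegative terms: a finite part is enlarged to all admissible pairs with
    coordinates in its two projections, which can only increase the sum, and the enlarged sum is
    iterated. *)
Lemma sum_le_pair (I J : choiceType) (D : set I) (D' : I -> set J) (f : I -> J -> R) g C :
  (forall i j, D i -> D' i j -> 0 <= f i j) ->
  (forall i, D i -> sum_le (D' i) (f i) (g i)) -> sum_le D g C ->
  sum_le [set x | D x.1 /\ D' x.1 x.2] (fun x => f x.1 x.2) C.
Proof.
move=> f0 Hf Hg s us sD.
apply: (@le_trans _ _ (\sum_(i <- undup (unzip1 s)) \sum_(j <- undup (unzip2 s) | j \in D' i) f i j)).
  rewrite (eq_bigr (fun i => \sum_(j <- [seq j <- undup (unzip2 s) | j \in D' i]) f i j)); last first.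
    by move=> i _; rewrite big_filter.
  have -> : forall (t1 : seq I) (t2 : I -> seq J), \sum_(i <- t1) \sum_(j <- t2 i) f i j =
      \sum_(x <- [seq (i, j) | i <- t1, j <- t2 i]) f x.1 x.2.
    by move=> t1 t2; rewrite big_allpairs_dep.
  apply: ler_sum_subset => //.
  - apply: allpairs_uniq_dep => [|i _|[a b] [c d] _ _ /= []]; rewrite ?filter_uniq ?undup_uniq//.
    by move=> -> ->.
  - move=> [i j] h; apply/allpairsPdep; exists i, j; split => //=.
      by rewrite mem_undup; apply/mapP; exists (i, j).
    rewrite mem_filter mem_undup; apply/andP; split; last by apply/mapP; exists (i, j).
    by apply/mem_set; case: (sD _ h).
  - move=> x /allpairsPdep[i [j [hi hj ->]]]/=; apply: f0.
      by move: hi; rewrite mem_undup => /mapP[y /sD[h _] ->].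
    by move: hj; rewrite mem_filter => /andP[/set_mem].
apply: le_trans (Hg (undup (unzip1 s)) (undup_uniq _) _); last first.
  by move=> i; rewrite mem_undup => /mapP[y /sD[h _] ->].
rewrite big_seq [leRHS]big_seq; apply: ler_sum => i.
rewrite mem_undup => /mapP[y /sD[h _] ->].
rewrite -big_filter; apply: Hf => //; first by rewrite filter_uniq// undup_uniq.
by move=> j; rewrite mem_filter => /andP[/set_mem].
Qed.

Lemma sum_le_esum (I : choiceType) (D : set I) (f : I -> R) C :
  (forall i, 0 <= f i) -> sum_le D f C -> (\esum_(i in D) (f i)%:E <= C%:E)%E.
Proof.
move=> f0 H; apply: ge_ereal_sup => _ [X [finX XD] <-].
rewrite fsbig_finite//= sumEFin lee_fin; apply: H; first exact: finmap.fset_uniq.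
by move=> i; rewrite in_fset_set// => /set_mem /XD.
Qed.

Lemma esum_sum_le (I : choiceType) (D : set I) (f : I -> R) C :
  (forall i, 0 <= f i) -> (\esum_(i in D) (f i)%:E <= C%:E)%E -> sum_le D f C.
Proof.
move=> f0 H s us sD; rewrite -lee_fin; apply: le_trans H.
apply: esum_ge; exists [set` s]; first by split; [exact: finite_seq|move=> i /= /sD].
by rewrite -fsbig_seq// sumEFin.
Qed.

Lemma abs_summableP (I : choiceType) (D : set I) (f : I -> R[i]) :
  abs_summable D f <-> exists C, sum_le D (fun i => nrm (f i)) C.
Proof.
rewrite /abs_summable /summable.
have E : (\esum_(i in D) `|(nrm (f i))%:E| = \esum_(i in D) (nrm (f i))%:E)%E.
  by apply: eq_esum => i _; rewrite abse_EFin ger0_norm// nrm_ge0.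
rewrite E; split=> [fD|[C /sum_le_esum h]]; last first.
  by apply: le_lt_trans (h (fun i => nrm_ge0 _)) _; rewrite ltry.
exists (fine (\esum_(i in D) (nrm (f i))%:E)%E); apply: esum_sum_le => [i|]; first exact: nrm_ge0.
rewrite fineK//; apply/fin_numPlt; rewrite fD andbT.
by apply: lt_le_trans (esum_ge0 _) => // i _; rewrite lee_fin nrm_ge0.
Qed.

End BoundedSums.

(** * Unconditional sums of complex terms *)

Section HasSum.
Context (R : realType).

(** Convergence along finite sets, with duplicate-free sequences as finite sets. Both t and s may
    contain indices outside D; these are filtered out of the sum. *)
Definition has_sum (I : choiceType) (D : set I) (f : I -> R[i]) (S : R[i]) : Prop :=
  forall e : R, 0 < e -> exists t : seq I, forall s : seq I, uniq s -> {subset t <= s} ->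
    nrm (\sum_(i <- s | i \in D) f i - S) < e.

Lemma has_sum_csum (I : choiceType) (D : set I) (f : I -> R[i]) S :
  has_sum D f S -> csum D f = S.
Proof.
move=> H; rewrite /csum /summability.sum.
have FF := @summability.totally_filter I.
apply: (@cvg_lim (Cx R)) => //.
apply/cvgrPdist_lt => e e0.
(* In the partial order of [R[i]] a positive element is real. *)
have eE : e = ((complex.Re e)%:C)%C.
  by rewrite RRe_real// ger0_real// ltW.
have re0 : 0 < complex.Re e by move: e0; rewrite {1}eE ltcR.
have [t ht] := H _ re0.
exists (finmap.seq_fset tt t) => // B tB.
rewrite eE [X in X < _]normr_nrm ltcR -nrmN opprB.
rewrite /summability.partial_sum -(finmap.big_seq_fsetE _ _ xpredT (fun i => if i \in D then f i else 0)).
rewrite -big_mkcond/=; apply: ht; first exact: finmap.fset_uniq.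
by move=> i it; apply: (finmap.fsubsetP (tB : finmap.fsubset _ _)); rewrite finmap.seq_fsetE.
Qed.

Lemma has_sum_lin (I : choiceType) (D : set I) (f g : I -> R[i]) (a S T : R[i]) :
  has_sum D f S -> has_sum D g T -> has_sum D (fun i => a * f i + g i) (a * S + T).
Proof.
move=> Hf Hg e e0.
have a1 : 0 < 2 * (nrm a + 1) by rewrite mulr_gt0// ltr_wpDl// nrm_ge0.
have [t ht] := Hf (e / (2 * (nrm a + 1))) (divr_gt0 e0 a1).
have [u hu] := Hg (e / 2) (divr_gt0 e0 (ltr0Sn _ 1)).
exists (t ++ u) => s us sub.
have {}ht := ht s us (fun i it => sub i (ltac:(rewrite mem_cat it//))).
have {}hu := hu s us (fun i it => sub i (ltac:(rewrite mem_cat it orbT//))).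
rewrite big_split/= -mulr_sumr.
rewrite (_ : _ - _ = a * (\sum_(i <- s | i \in D) f i - S) + (\sum_(i <- s | i \in D) g i - T)); last by ring.
apply: le_lt_trans (nrmD _ _) _; rewrite nrmM.
have h1 : nrm a * nrm (\sum_(i <- s | i \in D) f i - S) <= e / 2.
  apply: (@le_trans _ _ ((nrm a + 1) * (e / (2 * (nrm a + 1))))).
    by apply: ler_pM; rewrite ?nrm_ge0 ?lerDl// ltW.
  rewrite le_eqVlt; apply/orP; left; apply/eqP; field.
  by rewrite gt_eqF// ltr_wpDl// nrm_ge0.
lra.
Qed.

Lemma has_sum0 (I : choiceType) (D : set I) : has_sum D (fun=> 0) 0.
Proof. by move=> e e0; exists [::] => s _ _; rewrite big1// subr0 nrm0. Qed.

Lemma has_sumZ (I : choiceType) (D : set I) (f : I -> R[i]) (a S : R[i]) :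
  has_sum D f S -> has_sum D (fun i => a * f i) (a * S).
Proof.
move=> H; rewrite -[a * S]addr0 (_ : (fun _ => _) = fun i => a * f i + 0).
  by apply: has_sum_lin => //; exact: has_sum0.
by apply/funext => i; rewrite addr0.
Qed.

Lemma has_sum_sum (I : choiceType) (D : set I) (J : Type) (r : seq J)
    (f : J -> I -> R[i]) (a S : J -> R[i]) :
  (forall j, has_sum D (f j) (S j)) ->
  has_sum D (fun i => \sum_(j <- r) a j * f j i) (\sum_(j <- r) a j * S j).
Proof.
move=> H; elim: r => [|j r IH].
  rewrite big_nil (_ : (fun _ => _) = fun=> 0); first exact: has_sum0.
  by apply/funext => i; rewrite big_nil.
rewrite big_cons (_ : (fun _ => _) = fun i => a j * f j i + \sum_(j <- r) a j * f j i).
  exact: has_sum_lin.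
by apply/funext => i; rewrite big_cons.
Qed.

Lemma has_sum_ext (I : choiceType) (D : set I) (f g : I -> R[i]) S :
  (forall i, D i -> f i = g i) -> has_sum D f S -> has_sum D g S.
Proof.
move=> fg H e e0; have [t ht] := H e e0; exists t => s us ts.
by rewrite (eq_bigr f) => [|i /set_mem /fg//]; exact: ht.
Qed.

Lemma has_sum_le (I : choiceType) (D : set I) (f : I -> R[i]) S C :
  sum_le D (fun i => nrm (f i)) C -> has_sum D f S -> nrm S <= C.
Proof.
move=> HC H; apply/ler_addgt0Pl => e e0.
have [t ht] := H e e0.
have := ht (undup t) (undup_uniq t) (fun i it => ltac:(rewrite mem_undup//)).
set T := \sum_(i <- _ | _) _ => h.
have hT : nrm T <= C.
  apply: le_trans (nrm_sum _ _ _) _; rewrite -big_filter; apply: HC.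
    by rewrite filter_uniq// undup_uniq.
  by move=> i; rewrite mem_filter => /andP[/set_mem].
have -> : S = T - (T - S) by ring.
by apply: le_trans (nrmD _ _) _; rewrite nrmN addrC lerD// ltW.
Qed.

Lemma has_sum_bij (I J : choiceType) (D : set I) (D' : set J) (phi : I -> J)
    (f : J -> R[i]) S :
  set_bij D D' phi -> has_sum D' f S -> has_sum D (f \o phi) S.
Proof.
move=> [/= im inj sur] H e e0; have [t ht] := H e e0.
(* The inverse of [phi] takes values in [option I], since I may have no element to serve as a
   default. *)
have /choice [psi psiP] : forall j, exists o : option I,
    D' j -> exists2 i, o = Some i & D i /\ phi i = j.
  move=> j; case: (pselect (D' j)) => [Dj|nDj]; last by exists None.
  by have [i Di <-] := sur j Dj; exists (Some i) => _; exists i.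
exists (pmap psi t) => s us sub.
set s1 := map phi [seq i <- s | i \in D].
(* The hypothesis on t asks for a sequence containing all of t; [s2] supplies the members of t
   outside D', which contribute nothing. *)
set s2 := [seq j <- undup t | j \notin D'].
have us1 : uniq s1.
  rewrite map_inj_in_uniq ?filter_uniq// => x y.
  rewrite !mem_filter => /andP[xD _] /andP[yD _]; exact: inj.
have s1D j : j \in s1 -> j \in D'.
  rewrite /s1 => /mapP[x]; rewrite mem_filter => /andP[/set_mem xD _] ->.
  by apply/mem_set; exact: im.
have us12 : uniq (s1 ++ s2).
  rewrite cat_uniq us1 filter_uniq ?undup_uniq// andbT; apply/hasPn => j.
  rewrite mem_filter => /andP[jD _]; apply: contra jD; exact: s1D.
have tsub : {subset t <= s1 ++ s2}.
  move=> j jt; rewrite mem_cat [j \in s2]mem_filter mem_undup jt andbT.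
  case: (boolP (j \in D')) => jD; last by rewrite orbT.
  have [x psij [xD xj]] := psiP j (set_mem jD).
  rewrite orbF -xj; apply: map_f; rewrite mem_filter mem_set//=.
  by apply: sub; rewrite mem_pmap -psij map_f.
have := ht _ us12 tsub.
have -> : \sum_(j <- s1 ++ s2 | j \in D') f j = \sum_(j <- s1) f j.
  rewrite big_cat/= addrC big_seq_cond big1 ?add0r; last first.
    by move=> j /andP[]; rewrite mem_filter => /andP[/negP].
  rewrite big_seq_cond [RHS]big_seq; apply: eq_bigl => j.
  by case: (boolP (j \in s1)) => // /s1D ->.
by rewrite big_map big_filter.
Qed.

Lemma has_sum_nonneg (I : choiceType) (D : set I) (f : I -> R) C :
  (forall i, 0 <= f i) -> sum_le D f C ->
  exists S : R, has_sum D (fun i => (f i)%:C%C) (S%:C)%C.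
Proof.
move=> f0 HC.
pose A : set R := [set x | exists t : seq I, uniq t /\ x = \sum_(i <- t | i \in D) f i].
have ubA : has_sup A.
  split; first by exists 0, [::]; rewrite big_nil.
  exists C => x [t [ut ->]]; rewrite -big_filter; apply: HC; first by rewrite filter_uniq.
  by move=> i; rewrite mem_filter => /andP[/set_mem].
exists (sup A) => e e0.
have [x [t [ut ->]] hx] := sup_adherent e0 ubA.
exists t => s us ts.
rewrite -(big_morph _ (raddfD (real_complex R)) (raddf0 (real_complex R))) -raddfB nrmR.
have h1 : \sum_(i <- t | i \in D) f i <= \sum_(i <- s | i \in D) f i.
  rewrite -big_filter -[leRHS]big_filter; apply: ler_sum_subset; rewrite ?filter_uniq//.
  by move=> i; rewrite !mem_filter => /andP[-> /ts].
have h2 : \sum_(i <- s | i \in D) f i <= sup A.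
  by apply: ub_le_sup; [case: ubA|exists s].
by rewrite distrC ger0_norm ?subr_ge0//; lra.
Qed.

Lemma has_sum_exists (I : choiceType) (D : set I) (f : I -> R[i]) :
  abs_summable D f -> exists S, has_sum D f S.
Proof.
move=> /abs_summableP[C HC].
have ex (g : I -> R) : (forall i, `|g i| <= nrm (f i)) ->
    exists S : R[i], has_sum D (fun i => (g i)%:C%C) S.
  move=> gf.
  (* A real family g is written as |g| - (|g| - g), a difference of two nonnegative families with
     bounded finite sums. *)
  have [||S1 H1] := @has_sum_nonneg _ D (fun i => `|g i| - g i) (C + C).
  - by move=> i; rewrite subr_ge0 ler_norm.
  - move=> s us sD; apply: (@le_trans _ _ (\sum_(i <- s) (nrm (f i) + nrm (f i)))).
      apply: ler_sum => i _; apply: lerD => //.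
      by apply: le_trans (gf i); rewrite -normrN ler_norm.
    by rewrite big_split/= lerD// HC.
  have [||S2 H2] := @has_sum_nonneg _ D (fun i => `|g i|) C.
  - by move=> i.
  - by apply: sum_le_mono HC => i _; exact: gf.
  exists (-1 * (S1%:C)%C + (S2%:C)%C).
  apply: has_sum_ext (has_sum_lin (-1) H1 H2) => i _.
  by rewrite raddfB mulN1r opprB subrK.
have [S1 H1] := ex (fun i => complex.Re (f i)) (fun i => normRe_le _).
have [S2 H2] := ex (fun i => complex.Im (f i)) (fun i => normIm_le _).
exists (('i%C : R[i]) * S2 + S1).
apply: has_sum_ext (has_sum_lin 'i%C H2 H1) => i _.
by rewrite addrC -complexE.
Qed.

End HasSum.

(** * Sums over isotropic integral vectors *)

Section LatticeSums.
Context (R : realType).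
Implicit Types (A B : R).

Notation nabs x := ((absz x)%:R : R).

Lemma invX_le (A B : R) m : 0 < A -> A <= B -> B ^- m <= A ^- m.
Proof.
move=> A0 AB; rewrite lef_pV2 ?posrE ?exprn_gt0//; last exact: lt_le_trans AB.
by rewrite lerXn2r// nnegrE ltW//; exact: lt_le_trans AB.
Qed.

Lemma invX_scale (c A B : R) m : 0 < c -> 0 < A -> A <= c * B -> B ^- m <= c ^+ m * A ^- m.
Proof.
move=> c0 A0 AB; rewrite (_ : c ^+ m * A ^- m = (A / c) ^- m).
  by apply: invX_le; rewrite ?divr_gt0// ler_pdivrMr// mulrC.
by rewrite exprMn exprVn invfM invrK mulrC.
Qed.

Lemma sum_le_nat A : 1 <= A -> sum_le setT (fun m : nat => (A + m%:R) ^- 2) (2 * A^-1).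
Proof.
move=> A1 s us _.
pose N := (\max_(i <- s) i).+1.
have sub : {subset s <= iota 0 N}.
  by move=> i si; rewrite mem_iota/= add0n ltnS; exact: leq_bigmax_seq.
apply: le_trans (ler_sum_subset us (iota_uniq _ _) sub _) _.
  by move=> i _; rewrite invr_ge0 exprn_ge0// addr_ge0//; lra.
rewrite (_ : iota 0 N = index_iota 0 N); last by rewrite /index_iota subn0.
(* Telescoping: B^-2 <= 2 (1/B - 1/(B + 1)) as soon as B >= 1. *)
have : \sum_(0 <= i < N) (A + i%:R) ^- 2 <= 2 * (A^-1 - (A + N%:R)^-1).
  elim: {sub} N => [|m IH]; first by rewrite big_geq// addr0 subrr mulr0.
  rewrite big_nat_recr//=; apply: le_trans (lerD IH (lexx _)) _.
  have B1 : 1 <= A + m%:R by rewrite -[1]addr0 lerD.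
  rewrite (_ : A + m.+1%:R = A + m%:R + 1); last by rewrite -addn1 natrD addrA.
  set B := A + m%:R in B1 *.
  rewrite -subr_ge0 (_ : _ - _ = (B - 1) / (B ^+ 2 * (B + 1))); last first.
    by field; apply/andP; split; lra.
  by rewrite divr_ge0 ?mulr_ge0 ?exprn_ge0//; lra.
move=> h; apply: le_trans h _; rewrite ler_pM2l// lerBlDr lerDl invr_ge0 addr_ge0//; lra.
Qed.

Lemma sum_le_int A (p : nat) : 1 <= A ->
  sum_le setT (fun x : int => (A + nabs x) ^- p.+2) (4 * A ^- p.+1).
Proof.
move=> A1.
have A0 : 0 < A by lra.
(* The sum splits into the half-lines x >= 0 and x <= 0, on each of which [absz] is injective; the p
   surplus powers are bounded by A^-p. *)
have half (D : set int) : set_inj D absz ->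
    sum_le D (fun x : int => (A + nabs x) ^- p.+2) (2 * A ^- p.+1).
  move=> inj.
  have := sum_le_inj inj (fun _ _ => I) (sum_le_nat A1).
  have Ap : 0 <= A ^- p by rewrite invr_ge0 exprn_ge0// ltW.
  move=> /(sum_leZ Ap); rewrite mulrCA -invfM -exprSr; apply: sum_le_mono => x _ /=.
  rewrite -addn2 exprD invfM ler_pM2r ?invr_gt0 ?exprn_gt0 ?ltr_wpDr//.
  by rewrite invX_le// lerDl.
rewrite (_ : 4 * _ = 2 * A ^- p.+1 + 2 * A ^- p.+1); last by ring.
apply: (@sum_leU _ _ _ [set x : int | 0 <= x] [set x : int | x <= 0]).
- by move=> x _; case: (leP 0 x) => h; [left|right => /=; rewrite ltW].
- by move=> x _; rewrite invr_ge0 exprn_ge0// addr_ge0// ltW.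
- by apply: half => x y /set_mem[_ /= h1] /set_mem[_ /= h2] h; lia.
- by apply: half => x y /set_mem[_ /= h1] /set_mem[_ /= h2] h; lia.
Qed.

Definition norm1 m (v : 'cV[int]_m) : R := \sum_i nabs (v i 0).

Lemma norm1_ge0 m (v : 'cV[int]_m) : 0 <= norm1 v.
Proof. by apply: sumr_ge0 => i _. Qed.

(* Summing over one integer coordinate lowers the exponent by one. *)
Lemma sum_le_vec m A (p : nat) : 1 <= A ->
  sum_le setT (fun v : 'cV[int]_m => (A + norm1 v) ^- (p.+1 + m)) (4 ^+ m * A ^- p.+1).
Proof.
elim: m A p => [|m IH] A p A1.
  rewrite expr0 mul1r => s us _.
  apply: le_trans (ler_sum_subset us (t := [:: 0]) _ _ _) _ => //.
  - by move=> v _; rewrite inE; apply/eqP/matrixP => -[].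
  - by move=> v _; rewrite invr_ge0 exprn_ge0// addr_ge0 ?norm1_ge0//; lra.
  by rewrite big_seq1 addn0 /norm1 big_ord0 addr0.
pose phi (v : 'cV[int]_(1 + m)) := (usubmx v 0 0, dsubmx v).
pose f (x : int) (v : 'cV[int]_m) := (A + nabs x + norm1 v) ^- (p.+2 + m).
have H : sum_le setT (fun x : int * 'cV[int]_m => f x.1 x.2) (4 ^+ m.+1 * A ^- p.+1).
  apply: sum_le_mono (_ : forall x, _ -> _ <= f x.1 x.2) _ => //.
  rewrite (_ : setT = [set x : int * 'cV[int]_m | setT x.1 /\ (fun=> setT) x.1 x.2]); last first.
    by apply/seteqP.
  apply: (@sum_le_pair R _ _ setT (fun=> setT) f (fun x => 4 ^+ m * (A + nabs x) ^- p.+2)).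
  - by move=> i j _ _; rewrite /f invr_ge0 exprn_ge0// !addr_ge0 ?norm1_ge0//; lra.
  - by move=> i _; apply: IH; rewrite -[1]addr0 lerD.
  - by rewrite exprSr -mulrA; apply: sum_leZ; [rewrite exprn_ge0|exact: sum_le_int].
have phi_inj : set_inj setT phi.
  by move=> x y _ _ /= e; rewrite -[x]vsubmxK -[y]vsubmxK; case: e => h ->; congr col_mx;
    apply/matrixP => i j; rewrite !ord1.
apply: sum_le_mono (sum_le_inj phi_inj (fun _ _ => I) H) => v _ /=.
have E : nabs (usubmx v 0 0) + norm1 (dsubmx v) = norm1 v.
  rewrite /norm1 [RHS](@big_split_ord _ _ _ 1 m) /= big_ord1; congr (_ + _).
    by rewrite mxE.
  by apply: eq_bigr => i _; rewrite mxE.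
by rewrite /f /phi/= -addrA E addnS.
Qed.

Lemma sum_le_inv2 : sum_le [set x : int | x != 0] (fun x => nabs x ^- 2) 16.
Proof.
have /(sum_leZ (ler0n R 4)) := @sum_le_int 1 0 (lexx _).
rewrite expr1n invr1 mulr1 -natrM => H.
apply: sum_le_mono (sum_le_inj (_ : set_inj _ id) (fun _ _ => I) H); last by move=> x y _ _.
move=> x /= x0; rewrite -[leLHS]mul1r.
have x1 : 1 <= nabs x by rewrite ler1n; lia.
rewrite ler_pdivrMr; last by rewrite exprn_gt0//; lra.
rewrite mulrAC ler_pdivlMr; last by rewrite exprn_gt0//; lra.
rewrite mul1r (_ : 4 = 2 ^+ 2); last by rewrite -natrX.
by rewrite -exprMn lerXn2r// ?nnegrE; lra.
Qed.

(* A coordinate vector [(a, b, c, d, v)] with [2 (a d + b c) = q v] and [|b| <= |a|]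
   is determined by [v], [h = gcd a b], [a' = a / h], [b' = b / h] and the
   quotient [t] of [c] by [a'], because [c] is determined modulo [a']. *)
Section Isotropic.
Context (m : nat) (q : 'cV[int]_m -> int).

Definition vec5 := (int * int * int * int * 'cV[int]_m)%type.

Definition norm5 (x : vec5) : R :=
  let: (a, b, c, d, v) := x in nabs a + nabs b + nabs c + nabs d + norm1 v.

(** Only the four hyperbolic coordinates are asked not to vanish together; when q is anisotropic
    this is the same as being nonzero. *)
Definition iso5 : set vec5 := [set x | let: (a, b, c, d, v) := x in
  [/\ 2 * (a * d + b * c) = q v & [|| a != 0, b != 0, c != 0 | d != 0]]].

Definition major5 : set vec5 := [set x | let: (a, b, c, d, v) := x in
  [/\ 2 * (a * d + b * c) = q v, a != 0 & (absz b <= absz a)%N]].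

Definition reduce5 (x : vec5) : vec5 := let: (a, b, c, d, v) := x in
  let h := gcdz a b in
  (h, (a %/ h)%Z, (b %/ h)%Z, (c %/ (a %/ h)%Z)%Z, v).

Lemma reduce5_inj : set_inj major5 reduce5.
Proof.
move=> [[[[a b] c] d] v] [[[[a2 b2] c2] d2] v2] /set_mem[/= e1 a0 ba] /set_mem[/= e2 a20 ba2].
case=> hh0 ha hb hc hv; subst v2.
have hh : gcdz a b = gcdz a2 b2 by rewrite /gcdz hh0.
have h0 : gcdz a b != 0 by rewrite gcdz_eq0 (negbTE a0).
have aE : a = a2.
  by rewrite -(divzK (dvdz_gcdl a b)) ha hh (divzK (dvdz_gcdl a2 b2)).
have bE : b = b2.
  by rewrite -(divzK (dvdz_gcdr a b)) hb hh (divzK (dvdz_gcdr a2 b2)).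
subst a2 b2.
set h := gcdz a b in h0 hc.
have [a' aE] : exists a', a = a' * h by exists (a %/ h)%Z; rewrite divzK// dvdz_gcdl.
have [b' bE] : exists b', b = b' * h by exists (b %/ h)%Z; rewrite divzK// dvdz_gcdr.
have a'E : (a %/ h)%Z = a' by rewrite aE mulzK.
rewrite a'E in hc.
have a'0 : a' != 0 by move: a0; rewrite aE mulf_eq0 negb_or => /andP[].
have cop : coprimez a' b'.
    have := mulz_gcdl a' b' h; rewrite -aE -bE -/h gez0_abs ?gcdz_ge0// => e.
  by rewrite /coprimez -(inj_eq (mulIf h0)) e mul1r.
(* Cancelling h in a d + b c = a d2 + b c2 leaves a' (d - d2) = b' (c2 - c), and a' is coprime to
   b'. With equal quotients by a' this gives c = c2. *)
have dv : (a' %| c2 - c)%Z.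
  rewrite -(Gauss_dvdzr _ cop); apply/dvdzP; exists (d - d2).
  have e : a * d + b * c = a * d2 + b * c2 by apply: (@mulfI _ 2) => //; rewrite e1 e2.
  apply: (mulfI h0); apply/eqP; rewrite -subr_eq0; apply/eqP.
  transitivity ((a * d2 + b * c2) - (a * d + b * c)); [by rewrite aE bE; ring|by rewrite e subrr].
have cE : c = c2.
  rewrite (divz_eq c a') (divz_eq c2 a') hc; congr (_ + _).
  by apply/eqP; rewrite eq_sym eqz_mod_dvd.
subst c2; congr (_, _, _, _, _).
apply: (mulfI a0); apply: (addIr (b * c)); apply: (@mulfI _ 2) => //; by rewrite e1 e2.
Qed.

(** Here |a'| |h| = |a| and |a'| |t| <= |c| + |a'|, the last term being the remainder of the
    division; as |a'| <= |a|, the factor 2 absorbs it. *)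
Lemma norm5_reduce x : major5 x -> let: (h, a, b, t, v) := reduce5 x in
  [/\ h != 0, a != 0, (absz b <= absz a)%N &
    nabs a * (nabs h + nabs t) + norm1 v <= 2 * norm5 x].
Proof.
case: x => [[[[a b] c] d] v] [/= e1 a0 ba].
have h0 : gcdz a b != 0 by rewrite gcdz_eq0 (negbTE a0).
set h := gcdz a b in h0 *.
have [a' aE] : exists a', a = a' * h by exists (a %/ h)%Z; rewrite divzK// dvdz_gcdl.
have [b' bE] : exists b', b = b' * h by exists (b %/ h)%Z; rewrite divzK// dvdz_gcdr.
have -> : (a %/ h)%Z = a' by rewrite aE mulzK.
have -> : (b %/ h)%Z = b' by rewrite bE mulzK.
have a'0 : a' != 0 by move: a0; rewrite aE mulf_eq0 negb_or => /andP[].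
split=> //.
  by move: ba; rewrite aE bE !abszM leq_pmul2r// absz_gt0.
have h1 : nabs a = nabs a' * nabs h by rewrite aE abszM natrM.
have h2 : nabs a' * nabs (c %/ a')%Z <= nabs c + nabs a'.
  rewrite -natrM -natrD ler_nat.
  have := divz_eq c a'; have := ltz_mod c a'0; have := modz_ge0 c a'0.
  move: (c %/ a')%Z (c %% a')%Z => t r r0 r1 ->; nia.
have h3 : nabs a' <= nabs a.
  rewrite h1 ler_peMr// ler1n; lia.
have := norm1_ge0 v; have := ler0n R (absz b); have := ler0n R (absz c); have := ler0n R (absz d).
rewrite (_ : gcdn _ _ = absz h)// mulrDr -h1; lra.
Qed.

(** The exponent m + 3 is spent as follows. Summing over v uses m and leaves |a'|^-3 (|h| + |t|)^-3;
    summing over t leaves |a'|^-3 |h|^-2; the O(|a'|) values of b' leave |a'|^-2 |h|^-2, which is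
    summable. [H1] to [H5] go through this backwards. The constants are 4^m for v, 4 for t, 32 = 8 *
    4 for b' and 16 for each of a' and h. *)
Lemma sum_le_major5 : exists C, sum_le major5 (fun x => norm5 x ^- (m + 3)) C.
Proof.
pose W (x : vec5) : R := let: (h, a, b, t, v) := x in
   (nabs a * (nabs h + nabs t) + norm1 v) ^- (m + 3).
pose D1 := [set x : int * int | x.1 != 0 /\ x.2 != 0].
pose D2 := [set x : int * int * int | D1 x.1 /\ (absz x.2 <= absz x.1.2)%N].
pose D3 := [set x : int * int * int * int | D2 x.1 /\ True].
pose D4 := [set x : vec5 | D3 x.1 /\ True].
have nabs1 (x : int) : x != 0 -> 1 <= nabs x by move=> x0; rewrite ler1n; lia.
pose K : R := 4 ^+ m.
have K0 : 0 <= K by rewrite exprn_ge0.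
have H1 : sum_le [set x : int | x != 0] (fun h => 32 * 4 * K * 16 * nabs h ^- 2) (32 * 4 * K * 16 * 16).
  by apply: sum_leZ sum_le_inv2; rewrite !mulr_ge0.
have H2 : sum_le D1 (fun x => 32 * 4 * K * nabs x.1 ^- 2 * nabs x.2 ^- 2) (32 * 4 * K * 16 * 16).
  apply: (@sum_le_pair R _ _ [set x : int | x != 0] (fun=> [set x : int | x != 0])
    (fun h a => 32 * 4 * K * nabs h ^- 2 * nabs a ^- 2) _ _ _ _ H1).
    by move=> i j _ _; rewrite !mulr_ge0// invr_ge0 exprn_ge0.
  move=> h h0; rewrite -(mulrAC _ _ 16); apply: sum_leZ sum_le_inv2.
  by rewrite !mulr_ge0// invr_ge0 exprn_ge0.
have H3 : sum_le D2 (fun x => 4 * K * nabs x.1.1 ^- 2 * nabs x.1.2 ^- 3) (32 * 4 * K * 16 * 16).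
  apply: (@sum_le_pair R _ _ D1 (fun x => [set b | (absz b <= absz x.2)%N])
    (fun x b => 4 * K * nabs x.1 ^- 2 * nabs x.2 ^- 3) _ _ _ _ H2).
    by move=> i j _ _; rewrite !mulr_ge0// invr_ge0 exprn_ge0.
  move=> [h a] [/= h0 a0].
  rewrite (_ : 32 * 4 * K * _ * _ = 4 * K * nabs h ^- 2 * (8 * (4 * nabs a ^- 2))); last by ring.
  apply: sum_leZ; first by rewrite !mulr_ge0// invr_ge0 exprn_ge0.
  (* Instead of counting the b', |a'|^-3 is compared with 8 (|a'| + |b'|)^-3, using |b'| <= |a'|,
     and summed over all integers. *)
  have := sum_leZ (ler0n R 8) (@sum_le_int (nabs a) 1 (nabs1 _ a0)) => H.
  apply: sum_le_mono (sum_le_inj (_ : set_inj _ id) (fun _ _ => I) H); last by move=> x y _ _.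
  move=> b /= ba; have a1 := nabs1 _ a0.
  have ba' : nabs b <= nabs a by rewrite ler_nat.
  have b0 : 0 <= nabs b by [].
  rewrite -[leLHS]mul1r ler_pdivrMr; last by rewrite exprn_gt0//; lra.
  rewrite mulrAC ler_pdivlMr; last by rewrite exprn_gt0//; lra.
  rewrite mul1r (_ : 8 = 2 ^+ 3); last by rewrite -natrX.
  by rewrite -exprMn lerXn2r// ?nnegrE; lra.
have H4 : sum_le D3 (fun x => K * nabs x.1.1.2 ^- 3 * (nabs x.1.1.1 + nabs x.2) ^- 3) (32 * 4 * K * 16 * 16).
  apply: (@sum_le_pair R _ _ D2 (fun x => setT)
    (fun x t => K * nabs x.1.2 ^- 3 * (nabs x.1.1 + nabs t) ^- 3) _ _ _ _ H3).
    by move=> i j _ _; rewrite !mulr_ge0// invr_ge0 exprn_ge0// addr_ge0.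
  move=> [[h a] b] [[/= h0 a0] ba].
  rewrite (_ : 4 * K * _ * _ = K * nabs a ^- 3 * (4 * nabs h ^- 2)); last by ring.
  apply: sum_leZ (@sum_le_int (nabs h) 1 (nabs1 _ h0)).
  by rewrite !mulr_ge0// invr_ge0 exprn_ge0.
have H5 : sum_le D4 W (32 * 4 * K * 16 * 16).
  rewrite (_ : W = fun x : vec5 => (nabs x.1.1.1.2 * (nabs x.1.1.1.1 + nabs x.1.2) + norm1 x.2) ^- (m + 3)); last first.
    by apply/funext => -[[[[? ?] ?] ?] ?].
  apply: (@sum_le_pair R _ _ D3 (fun x => setT)
    (fun x v => (nabs x.1.1.2 * (nabs x.1.1.1 + nabs x.2) + norm1 v) ^- (m + 3)) _ _ _ _ H4).
    by move=> i j _ _; rewrite invr_ge0 exprn_ge0// addr_ge0 ?norm1_ge0// mulr_ge0// addr_ge0.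
  move=> [[[h a] b] t] [[[/= h0 a0] ba] _].
  rewrite -mulrA -invfM -exprMn [(m + 3)%N]addnC.
  apply: sum_le_vec; apply: mulr_ege1; rewrite ?nabs1//.
  by rewrite ler_wpDr// nabs1.
exists (2 ^+ (m + 3) * (32 * 4 * K * 16 * 16)).
have D : forall x, major5 x -> D4 (reduce5 x).
  by move=> x /norm5_reduce; case: (reduce5 x) => [[[[h a] b] t] v] [? ? ? _].
apply: sum_le_mono (sum_leZ _ (sum_le_inj reduce5_inj D H5)); last by rewrite exprn_ge0.
move=> x /norm5_reduce /=; rewrite /W; case: (reduce5 x) => [[[[h a] b] t] v] [h0 a0 ba le].
have P : 0 < nabs a * (nabs h + nabs t) + norm1 v.
  by rewrite ltr_wpDr ?norm1_ge0// mulr_gt0 ?ltr_wpDr//; apply: lt_le_trans (nabs1 _ _).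
by apply: invX_scale.
Qed.

(** If a or b is nonzero, the exchange (a, b, c, d) -> (b, a, d, c), which preserves the equation,
    reduces to |b| <= |a|. If a = b = 0, then q(v) = 0, so v = 0 and the vector is the pair (c, d),
    for which exponent 3 suffices. *)
Lemma sum_le_iso5 : (forall v, q v = 0 -> v = 0) ->
  exists C, sum_le iso5 (fun x => norm5 x ^- (m + 3)) C.
Proof.
move=> q0; have [C H] := sum_le_major5.
have N0 x : 0 <= norm5 x ^- (m + 3).
  by case: x => [[[[a b] c] d] v]; rewrite invr_ge0 exprn_ge0// !addr_ge0// norm1_ge0.
pose sw (x : vec5) : vec5 := let: (a, b, c, d, v) := x in (b, a, d, c, v).
pose Da := [set x : vec5 | let: (a, b, c, d, v) := x in a != 0 /\ (absz b <= absz a)%N].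
pose Db := [set x : vec5 | let: (a, b, c, d, v) := x in b != 0 /\ (absz a <= absz b)%N].
pose D0 := [set x : vec5 | let: (a, b, c, d, v) := x in a = 0 /\ b = 0].
have id_inj (E : set vec5) : set_inj E id by move=> x y _ _.
have Ha : sum_le (iso5 `&` Da) (fun x => norm5 x ^- (m + 3)) C.
  by apply: sum_le_inj (id_inj _) _ H => -[[[[a b] c] d] v] [[e _] []].
have Hb : sum_le (iso5 `&` Db) (fun x => norm5 x ^- (m + 3)) C.
  have inj : set_inj (iso5 `&` Db) sw.
    by move=> [[[[a b] c] d] v] [[[[a2 b2] c2] d2] v2] _ _ [-> -> -> -> ->].
  apply: sum_le_mono (sum_le_inj inj _ H).
    move=> [[[[a b] c] d] v] _ /=.
    by rewrite [nabs b + _]addrC -!addrA [nabs d + (_ + _)]addrCA.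
  by move=> [[[[a b] c] d] v] [[e _] [? ?]]; split=> //; rewrite addrC.
have [C0 H0] : exists C0, sum_le (iso5 `&` D0) (fun x => norm5 x ^- (m + 3)) C0.
  have Hc : sum_le setT (fun x : int * int => (1 + nabs x.1 + nabs x.2) ^- 3) (4 * (4 * 1 ^- 1)).
    rewrite (_ : setT = [set x : int * int | setT x.1 /\ (fun=> setT) x.1 x.2]); last first.
      by apply/seteqP.
    apply: (@sum_le_pair R _ _ setT (fun=> setT) (fun c d => (1 + nabs c + nabs d) ^- 3)
             (fun c => 4 * (1 + nabs c) ^- 2)).
    - by move=> c d _ _; rewrite invr_ge0 exprn_ge0// !addr_ge0.
    - by move=> c _; apply: sum_le_int; rewrite lerDl.
    - by apply: sum_leZ => //; apply: sum_le_int.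
  pose pr (x : vec5) : int * int := let: (a, b, c, d, v) := x in (c, d).
  have inj : set_inj (iso5 `&` D0) pr.
    move=> [[[[a b] c] d] v] [[[[a2 b2] c2] d2] v2] /set_mem[[e1 _] [a0 b0]] /set_mem[[e2 _] [a20 b20]] [-> ->].
    have qv : q v = 0 by rewrite -e1 a0 b0 !mul0r addr0 mulr0.
    have qv2 : q v2 = 0 by rewrite -e2 a20 b20 !mul0r addr0 mulr0.
    by rewrite a0 b0 a20 b20 (q0 v qv) (q0 v2 qv2).
  exists (2 ^+ 3 * (4 * (4 * 1 ^- 1))).
  apply: sum_le_mono (sum_leZ _ (sum_le_inj inj (fun _ _ => I) Hc)); last by rewrite exprn_ge0.
  move=> [[[[a b] c] d] v] [[e1 nz] [a0 b0]] /=; subst a b.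
  move: nz; rewrite !eqxx/= => nz.
  have n1 : 1 <= nabs c + nabs d by rewrite -natrD ler1n; lia.
  have v0 := norm1_ge0 v.
  rewrite !add0r.
  set N := nabs c + nabs d + norm1 v.
  have N1 : 1 <= N by rewrite /N; lra.
  apply: (@le_trans _ _ (N ^- 3)).
    rewrite lef_pV2 ?posrE ?exprn_gt0//; try lra.
    by rewrite ler_weXn2l// leq_addl.
  have c0 := ler0n R (absz c); have d0 := ler0n R (absz d).
  by apply: invX_scale; rewrite /N//; lra.
exists (C + (C + C0)).
apply: (@sum_leU _ _ _ Da (Db `|` D0)) => //.
- move=> [[[[a b] c] d] v] _; case: (eqVneq a 0) => [a0|a0]; case: (eqVneq b 0) => [b0|b0].
  + by right; right.
  + by right; left; split => //; rewrite a0.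
  + by left; split => //; rewrite b0.
  + by case: (leqP (absz b) (absz a)) => h; [left|right; left; split => //; exact: ltnW].
- apply: (@sum_leU _ _ _ Db D0) => //.
  + by apply: sum_le_inj (id_inj _) _ Hb => x [[? _] ?].
  + by apply: sum_le_inj (id_inj _) _ H0 => x [[? _] ?].
Qed.

End Isotropic.
End LatticeSums.

(** * Forms with a hyperbolic plane split off *)

Section HyperbolicCoordinates.
Context (T : comPzRingType).

Definition cx m (a : T) (v : 'cV[T]_m) (b : T) : 'cV[T]_(1 + (m + 1)) :=
  col_mx a%:M (col_mx v b%:M).

Lemma cx_surj m (x : 'cV[T]_(1 + (m + 1))) : exists a v b, x = cx a v b.
Proof.
exists (usubmx x 0 0), (usubmx (dsubmx x)), (dsubmx (dsubmx x) 0 0).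
by rewrite /cx -!mx11_scalar !vsubmxK.
Qed.

Lemma cx_inj m a a' (v v' : 'cV[T]_m) b b' :
  cx a v b = cx a' v' b' -> [/\ a = a', v = v' & b = b'].
Proof.
move=> /eq_col_mx[/matrixP/(_ 0 0) ea /eq_col_mx[-> /matrixP/(_ 0 0) eb]].
by move: ea eb; rewrite !mxE /= !mulr1n => -> ->.
Qed.

Lemma cxD m a a' (v v' : 'cV[T]_m) b b' :
  cx a v b + cx a' v' b' = cx (a + a') (v + v') (b + b').
Proof. by rewrite /cx !add_col_mx !raddfD. Qed.

Lemma cxZ m k a (v : 'cV[T]_m) b : k *: cx a v b = cx (k * a) (k *: v) (k * b).
Proof. by rewrite /cx !scale_col_mx !scale_scalar_mx. Qed.

Lemma cx0 m : cx 0 (0 : 'cV[T]_m) 0 = 0.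
Proof. by rewrite /cx !raddf0 !col_mx0. Qed.

Lemma hyp_ext_cx m (A : 'M[T]_m) a v b : hyp_ext A *m cx a v b = cx b (A *m v) a.
Proof.
rewrite /hyp_ext /cx mul_block_col mul0mx add0r mul_row_col mul0mx add0r mul1mx.
congr col_mx; rewrite mul_col_mx mul_block_col !mul0mx mul1mx add_col_mx.
by rewrite !addr0 add0r.
Qed.

Lemma dot_cx m a a' (v v' : 'cV[T]_m) b b' :
  ((cx a v b)^T *m cx a' v' b') 0 0 = a * a' + (v^T *m v') 0 0 + b * b'.
Proof.
rewrite /cx !tr_col_mx !mul_row_col !tr_scalar_mx -!scalar_mxM.
by rewrite !mxE /= !mulr1n addrA.
Qed.

End HyperbolicCoordinates.

Definition bf (T : comPzRingType) m (A : 'M[T]_m) (x y : 'cV[T]_m) : T := bil A x y.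

Section Bilinear.
Context (T : comPzRingType) (m : nat) (A : 'M[T]_m).
Implicit Types (x y z : 'cV[T]_m).

Lemma bfDl x y z : bf A (x + y) z = bf A x z + bf A y z.
Proof. by rewrite /bf linearD/= !mulmxDl mxE. Qed.
Lemma bfDr x y z : bf A z (x + y) = bf A z x + bf A z y.
Proof. by rewrite /bf mulmxDr mxE. Qed.
Lemma bfZl k x z : bf A (k *: x) z = k * bf A x z.
Proof. by rewrite /bf linearZ/= -!scalemxAl mxE. Qed.
Lemma bfZr k x z : bf A z (k *: x) = k * bf A z x.
Proof. by rewrite /bf -scalemxAr mxE. Qed.
Lemma bfNl x z : bf A (- x) z = - bf A x z.
Proof. by rewrite /bf linearN/= !mulNmx mxE. Qed.
Lemma bfNr x z : bf A z (- x) = - bf A z x.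
Proof. by rewrite /bf mulmxN mxE. Qed.
Lemma bf0l z : bf A 0 z = 0. Proof. by rewrite /bf trmx0 !mul0mx mxE. Qed.
Lemma bf0r z : bf A z 0 = 0. Proof. by rewrite /bf mulmx0 mxE. Qed.

Lemma bfC x y : A^T = A -> bf A x y = bf A y x.
Proof.
by move=> As; rewrite /bf -[in LHS](trmxK (x^T *m A *m y)) mxE !trmx_mul trmxK As mulmxA.
Qed.

Lemma bf_mul (M : 'M[T]_m) x y : bf A (M *m x) (M *m y) = bf (M^T *m A *m M) x y.
Proof. by rewrite /bf trmx_mul !mulmxA. Qed.

Lemma bf_delta i j : bf A (delta_mx i 0) (delta_mx j 0) = A i j.
Proof. by rewrite /bf trmx_delta -rowE -colE !mxE. Qed.

End Bilinear.

Lemma bf_hyp_ext (T : comPzRingType) m (A : 'M[T]_m) a a' v v' b b' :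
  bf (hyp_ext A) (cx a v b) (cx a' v' b') = a * b' + bf A v v' + b * a'.
Proof. by rewrite /bf -mulmxA hyp_ext_cx dot_cx mulmxA. Qed.

Lemma bf_ext (T : comPzRingType) m (A B : 'M[T]_m) :
  (forall x y, bf A x y = bf B x y) -> A = B.
Proof. by move=> AB; apply/matrixP => i j; rewrite -(bf_delta A) -(bf_delta B) AB. Qed.

Section Morph.
Context (T U : comNzRingType) (f : {rmorphism T -> U}).

Lemma map_cx m a (v : 'cV[T]_m) b : map_mx f (cx a v b) = cx (f a) (map_mx f v) (f b).
Proof. by rewrite /cx !map_col_mx !map_scalar_mx. Qed.

Lemma map_hyp_ext m (A : 'M[T]_m) : map_mx f (hyp_ext A) = hyp_ext (map_mx f A).
Proof.
rewrite /hyp_ext map_block_mx map_row_mx map_col_mx map_block_mx !map_mx0.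
by rewrite map_mx1.
Qed.

Lemma map_bf m (A : 'M[T]_m) x y :
  f (bf A x y) = bf (map_mx f A) (map_mx f x) (map_mx f y).
Proof. by rewrite /bf map_trmx -!map_mxM [RHS]mxE. Qed.
End Morph.

Section Forms.
Context (F : comNzRingType) (n : nat) (S : 'M[int]_n).

Lemma inF_S0 : inF F (S0 S) = hyp_ext (- inF F S).
Proof. by rewrite /S0 /inF map_hyp_ext map_mxN. Qed.

Lemma inF_S1 : inF F (S1 S) = hyp_ext (inF F (S0 S)).
Proof. by rewrite /S1 /inF map_hyp_ext. Qed.

(** The entries d and g span the outer hyperbolic plane of [S1], p and q the inner one, and l
    carries the form -S. *)
Definition mk5 (d p : F) (l : 'cV[F]_n) (q g : F) : 'cV[F]_(dim1 n) := cx d (cx p l q) g.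

Lemma bf_S0 p p' l l' q q' :
  bf (inF F (S0 S)) (cx p l q) (cx p' l' q') = p * q' + q * p' - bf (inF F S) l l'.
Proof. by rewrite inF_S0 bf_hyp_ext /bf mulmxN mulNmx mxE addrAC. Qed.

Lemma bf_S1 d p l q g d' p' l' q' g' :
  bf (inF F (S1 S)) (mk5 d p l q g) (mk5 d' p' l' q' g') =
  d * g' + g * d' + p * q' + q * p' - bf (inF F S) l l'.
Proof. by rewrite inF_S1 bf_hyp_ext bf_S0; ring. Qed.

Lemma S1_mk5 d p l q g : inF F (S1 S) *m mk5 d p l q g = mk5 g q (- (inF F S *m l)) p d.
Proof. by rewrite inF_S1 hyp_ext_cx inF_S0 hyp_ext_cx mulNmx. Qed.

Lemma mk5_surj x : exists d p l q g, x = mk5 d p l q g.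
Proof.
have [d [y [g ->]]] := cx_surj x; have [p [l [q ->]]] := cx_surj y.
by exists d, p, l, q, g.
Qed.

Lemma mk5D d p l q g d' p' l' q' g' : mk5 d p l q g + mk5 d' p' l' q' g' =
  mk5 (d + d') (p + p') (l + l') (q + q') (g + g').
Proof. by rewrite /mk5 !cxD. Qed.

Lemma mk5Z k d p l q g : k *: mk5 d p l q g = mk5 (k * d) (k * p) (k *: l) (k * q) (k * g).
Proof. by rewrite /mk5 !cxZ. Qed.

End Forms.

Lemma inF_mul (F : pzRingType) m p r (A : 'M[int]_(m, p)) (B : 'M[int]_(p, r)) :
  inF F (A *m B) = inF F A *m inF F B.
Proof. exact: map_mxM. Qed.

Lemma inF_inj (F : numDomainType) m p : injective (@inF F m p).
Proof.
by move=> A B /matrixP h; apply/matrixP => i j; have := h i j; rewrite !mxE => /intr_inj.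
Qed.

Lemma inF_mk5 (F : comNzRingType) n d p (l : 'cV[int]_n) q g :
  inF F (mk5 d p l q g) = mk5 d%:~R p%:~R (inF F l) q%:~R g%:~R.
Proof. by rewrite /inF /mk5 !map_cx. Qed.

Lemma map_ratr_inF (F : numFieldType) m p (A : 'M[int]_(m, p)) :
  map_mx ratr (inF rat A) = inF F A.
Proof. by apply/matrixP => i j; rewrite !mxE ratr_int. Qed.

Section Symmetric.
Context (F : comNzRingType) (n : nat) (S : 'M[int]_n).
Hypothesis symS : S^T = S.

Lemma tr_S0 : (S0 S)^T = S0 S.
Proof.
rewrite /S0 /hyp_ext tr_block_mx !trmx0 tr_col_mx tr_row_mx tr_block_mx !trmx0 trmx1.
by rewrite linearN/= symS.
Qed.

Lemma tr_S1 : (S1 S)^T = S1 S.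
Proof.
rewrite /S1 /hyp_ext tr_block_mx !trmx0 tr_col_mx tr_row_mx tr_block_mx !trmx0 trmx1.
by rewrite tr_S0.
Qed.

Lemma tr_inF_S : (inF F S)^T = inF F S. Proof. by rewrite /inF map_trmx symS. Qed.
Lemma tr_inF_S0 : (inF F (S0 S))^T = inF F (S0 S). Proof. by rewrite /inF map_trmx tr_S0. Qed.
Lemma tr_inF_S1 : (inF F (S1 S))^T = inF F (S1 S). Proof. by rewrite /inF map_trmx tr_S1. Qed.
End Symmetric.

(** * Eichler transformations *)

(* The Eichler transformation of an isotropic vector [u] and [v] orthogonal to [u]
   with [Q(v) = q], run for time [t]. *)
Section Eichler.
Context (T : comNzRingType) (m : nat) (A : 'M[T]_m) (u v : 'cV[T]_m) (q : T).

Definition eichlerX (t : T) : 'M[T]_m :=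
  t *: (v *m u^T - u *m v^T) - (t ^+ 2 * q) *: (u *m u^T).

(** The shape I + X A is the one demanded by the discriminant kernel, and the parameter t joins the
    identity at t = 0 to the transformation at t = 1 inside the orthogonal group. *)
Definition eichler (t : T) : 'M[T]_m := 1%:M + eichlerX t *m A.

Lemma eichler_mul t x : eichler t *m x =
  x + (t * bf A u x) *: v - (t * bf A v x) *: u - (t ^+ 2 * q * bf A u x) *: u.
Proof.
have E (a b : 'cV[T]_m) : a *m b^T *m A *m x = bf A b x *: a.
  rewrite (_ : _ *m x = a *m (b^T *m A *m x)); last by rewrite !mulmxA.
  by rewrite [b^T *m A *m x]mx11_scalar mul_mx_scalar.
rewrite /eichler /eichlerX mulmxDl mul1mx !mulmxBl -!scalemxAl !mulmxBl.
by rewrite !E scalerBr !scalerA addrA !addrA.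
Qed.

Lemma eichler_ortho t : A^T = A -> bf A u u = 0 -> bf A u v = 0 -> bf A v v = 2 * q ->
  (eichler t)^T *m A *m eichler t = A.
Proof.
move=> sA uu uv vv; apply: bf_ext => x y; rewrite -bf_mul !eichler_mul.
have vu : bf A v u = 0 by rewrite bfC.
rewrite !(bfDl, bfDr, bfNl, bfNr, bfZl, bfZr) uu uv vv vu.
rewrite (bfC x u sA) (bfC x v sA); ring.
Qed.

End Eichler.

Lemma continuous_sum (K : numFieldType) (V : normedModType K) (X : topologicalType) (I : Type) (r : seq I)
    (f : I -> X -> V) :
  (forall i, continuous (f i)) -> continuous (fun x => \sum_(i <- r) f i x).
Proof.
move=> cf; elim: r => [|i r IH] x.
  by under eq_fun do rewrite big_nil; exact: cvg_cst.
under eq_fun do rewrite big_cons.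
by apply: cvgD; [exact: cf|exact: IH].
Qed.

(** * The identity component of the real orthogonal group *)

Section Component.
Context (R : realType).

(** Applied to left multiplications, this makes the identity component stable under products and
    inverses: multiplication by M carries 1 and N to M and M N. *)
Lemma component_image (X : topologicalType) (f : X -> X) (A : set X) x y :
  continuous f -> (forall z, A z -> A (f z)) ->
  connected_component A x y -> connected_component A (f x) (f y).
Proof.
move=> cf fA [C [Cx CA cC] Cy]; exists (f @` C); last by exists y.
split; [by exists x|by move=> _ [z /CA/fA ? <-]|].
by apply: connected_continuous_connected => //; exact: continuous_subspaceT.
Qed.

Lemma mulmx_continuous m p r (M : 'M[R]_(m, p)) :
  continuous (fun X : 'M[R]_(p, r) => M *m X).
Proof.
have -> : mulmx M = (fun X : 'M[R]_(p, r) => \sum_i \sum_j X i j *: (M *m delta_mx i j)).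
  apply/funext => X; rewrite {1}(matrix_sum_delta X) mulmx_sumr.
  by apply: eq_bigr => i _; rewrite mulmx_sumr; apply: eq_bigr => j _; rewrite scalemxAr.
apply: continuous_sum => i; apply: continuous_sum => j X.
have h : (X : 'M[R]_(p, r)) i j @[X --> X] --> X i j by exact: (@coord_continuous R p r i j X).
exact: (cvgZr_tmp (a := M *m delta_mx i j) h).
Qed.

Lemma quadratic_continuous (V : normedModType R) (a b c : V) :
  continuous (fun t : R => a + t *: b - (t * t) *: c).
Proof.
move=> t; apply: cvgB; last by apply: cvgZr_tmp; apply: cvgM; exact: cvg_id.
by apply: cvgD; [exact: cvg_cst|apply: cvgZr_tmp; exact: cvg_id].
Qed.

Context (n : nat) (S : 'M[int]_n).

Lemma orthoR1 : orthoR S (1%:M : 'M[R]_(dim1 n)).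
Proof. by rewrite /orthoR /= trmx1 mul1mx mulmx1. Qed.

Lemma orthoRM (M N : 'M[R]_(dim1 n)) : orthoR S M -> orthoR S N -> orthoR S (M *m N).
Proof.
rewrite /orthoR /= => hM hN; rewrite trmx_mul.
rewrite (_ : _ *m (M *m N) = N^T *m (M^T *m inF R (S1 S) *m M) *m N); last by rewrite !mulmxA.
by rewrite hM.
Qed.

Lemma orthoR_plus_sub (M : 'M[R]_(dim1 n)) : orthoR_plus S M -> orthoR S M.
Proof. exact: connected_component_sub. Qed.

Lemma orthoR_plusM (M N : 'M[R]_(dim1 n)) :
  orthoR_plus S M -> orthoR_plus S N -> orthoR_plus S (M *m N).
Proof.
move=> hM hN; have oM := orthoR_plus_sub hM; apply: connected_component_trans hM _.
rewrite -{1}(mulmx1 M); apply: (component_image (f := mulmx M)) => //.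
  exact: mulmx_continuous.
by move=> z; apply: orthoRM.
Qed.

Lemma orthoR_plusV (M N : 'M[R]_(dim1 n)) :
  N *m M = 1%:M -> orthoR S N -> orthoR_plus S M -> orthoR_plus S N.
Proof.
move=> NM hN hM; apply: connected_component_sym; rewrite -NM -{1}(mulmx1 N).
apply: (component_image (f := mulmx N)) => //.
  exact: mulmx_continuous.
by move=> z; apply: orthoRM.
Qed.

Lemma orthoR_plus_eichler (u v : 'cV[R]_(dim1 n)) (q : R) :
  S^T = S -> bf (inF R (S1 S)) u u = 0 -> bf (inF R (S1 S)) u v = 0 ->
  bf (inF R (S1 S)) v v = 2 * q -> orthoR_plus S (eichler (inF R (S1 S)) u v q 1).
Proof.
move=> sS uu uv vv; have sA := tr_inF_S1 R sS.
exists (eichler (inF R (S1 S)) u v q @` `[0, 1]).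
  split.
  - exists 0; first by rewrite /= in_itv/= lexx ler01.
    by rewrite /eichler /eichlerX scale0r expr0n/= mul0r scale0r subr0 mul0mx addr0.
  - by move=> _ [t _ <-]; exact: eichler_ortho.
  - apply: connected_continuous_connected; first exact: segment_connected.
    apply: continuous_subspaceT.
    rewrite (_ : eichler _ _ _ _ = fun t : R => 1%:M + t *: ((v *m u^T - u *m v^T) *m inF R (S1 S))
       - (t * t) *: (q *: (u *m u^T) *m inF R (S1 S))); last first.
      apply/funext => t; rewrite /eichler /eichlerX mulmxBl addrA expr2 -!scalemxAl.
      by rewrite scalerA.
    exact: quadratic_continuous.
by exists 1 => //; rewrite /= in_itv/= lexx ler01.
Qed.

End Component.

Lemma inFD (F : pzRingType) m p (A B : 'M[int]_(m, p)) : inF F (A + B) = inF F A + inF F B.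
Proof. exact: map_mxD. Qed.

Lemma inF1 (F : pzRingType) m : inF F 1%:M = 1%:M :> 'M[F]_m.
Proof. exact: map_mx1. Qed.

Lemma inF_tr (F : pzRingType) m p (A : 'M[int]_(m, p)) : inF F A^T = (inF F A)^T.
Proof. by rewrite /inF map_trmx. Qed.

Lemma inF_ortho (F : pzRingType) m (A M : 'M[int]_m) :
  M^T *m A *m M = A -> (inF F M)^T *m inF F A *m inF F M = inF F A.
Proof. by move=> oM; rewrite -inF_tr -!inF_mul oM. Qed.

Lemma inF_eichler (F : comNzRingType) m (A : 'M[int]_m) u v (q : int) :
  inF F (eichler A u v q 1) = eichler (inF F A) (inF F u) (inF F v) q%:~R 1.
Proof.
rewrite /eichler /eichlerX !expr1n !mul1r !scale1r /inF map_mxD map_mx1 map_mxM map_mxB.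
by rewrite map_mxZ map_mxB !map_mxM !map_trmx.
Qed.

(** * The discriminant kernel and its orbits *)

Section Kernel.
Context (R : realType) (n : nat) (S : 'M[int]_n).
Hypothesis hS : even_posdef R S.

Lemma symS : S^T = S. Proof. by case: hS. Qed.

Lemma S_pos (x : 'cV[R]_n) : x != 0 -> 0 < bf (inF R S) x x.
Proof. by case: hS => _ _; exact. Qed.

(** A real kernel vector would contradict positive definiteness, so det S is a nonzero integer,
    hence a unit in every field of characteristic zero considered here. *)
Lemma S_unit (F : numFieldType) : inF F S \in unitmx.
Proof.
have detS : \det S != 0.
  apply: contraT => /negPn/eqP detS0.
  have : \det (inF R S) == 0 by rewrite -[inF R S]/(map_mx intr S) det_map_mx detS0.
  case/det0P => w w0 wS; case: hS => _ _ /(_ w^T).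
  by rewrite trmx_eq0 trmxK wS mul0mx mxE ltxx => /(_ w0).
by rewrite unitmxE unitfE -[inF F S]/(map_mx intr S) det_map_mx intr_eq0.
Qed.

Lemma S_ker (F : numFieldType) (v : 'cV[F]_n) : inF F S *m v = 0 -> v = 0.
Proof. by move=> Sv; rewrite -[v](mulKmx (S_unit F)) Sv mulmx0. Qed.

Lemma S1_ker (F : numFieldType) (x : 'cV[F]_(dim1 n)) : inF F (S1 S) *m x = 0 -> x = 0.
Proof.
have [d [p [l [q [g ->]]]]] := mk5_surj x; rewrite S1_mk5 -[RHS]cx0 -(cx0 F n).
move=> /cx_inj[-> /cx_inj[-> /eqP h ->] ->].
move: h; rewrite oppr_eq0 => /eqP/S_ker ->.
by rewrite /mk5 !cx0.
Qed.

Lemma S1_int_unit : \det (S1 S) != 0.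
Proof.
apply: contraT => /negPn/eqP det0.
have : \det (inF R (S1 S))^T == 0.
  by rewrite det_tr -[inF R _]/(map_mx intr (S1 S)) det_map_mx det0.
case/det0P => w w0 wS.
have /S1_ker/eqP : inF R (S1 S) *m w^T = 0.
  by rewrite -[LHS]trmxK trmx_mul trmxK wS trmx0.
by rewrite trmx_eq0 (negbTE w0).
Qed.

Lemma orthoR_int (M : 'M[int]_(dim1 n)) :
  orthoR S (inF R M) -> M^T *m S1 S *m M = S1 S.
Proof.
rewrite /orthoR /= => h; apply: (@inF_inj R); rewrite !inF_mul.
by rewrite {1}/inF -map_trmx.
Qed.

Lemma orthoR_of_int (M : 'M[int]_(dim1 n)) :
  M^T *m S1 S *m M = S1 S -> orthoR S (inF R M).
Proof.
exact: inF_ortho.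
Qed.

Notation G := (disc_kernel R S).

Lemma disc_kernel_ortho M : G M -> M^T *m S1 S *m M = S1 S.
Proof. by case=> /orthoR_plus_sub/orthoR_int. Qed.

Lemma disc_kernel_unit M : G M -> M \in unitmx.
Proof.
move=> /disc_kernel_ortho /(congr1 determinant); rewrite !det_mulmx det_tr => h.
have : \det M * \det M = 1.
  by apply: (mulfI S1_int_unit); rewrite mulr1 -{2}h; ring.
by move=> e; rewrite unitmxE; apply/unitrP; exists (\det M).
Qed.

Lemma disc_kernel1 : G 1%:M.
Proof.
split; last by exists 0; rewrite mul0mx addr0.
rewrite /Gamma /= /inF map_mx1; apply: connected_component_refl; exact: orthoR1.
Qed.

Lemma disc_kernelM M N : G M -> G N -> G (M *m N).
Proof.
move=> [gM [X eX]] [gN [Y eY]]; split.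
  by rewrite /Gamma /= inF_mul; exact: orthoR_plusM.
exists (X + Y + X *m S1 S *m Y); rewrite {1}eX {1}eY.
by rewrite mulmxDr mulmx1 !mulmxDl mul1mx !mulmxA !addrA.
Qed.

Lemma disc_kernelV M : G M -> G (invmx M).
Proof.
move=> gM; have uM := disc_kernel_unit gM; have oM := disc_kernel_ortho gM.
case: gM => gM [X eX]; split.
  rewrite /Gamma /=; apply: orthoR_plusV gM.
    by rewrite -inF_mul mulVmx// /inF map_mx1.
  apply: orthoR_of_int; rewrite -{1}oM.
  rewrite (_ : _ *m invmx M = (M *m invmx M)^T *m S1 S *m (M *m invmx M)); last first.
    by rewrite trmx_mul !mulmxA.
  by rewrite mulmxV// trmx1 mul1mx mulmx1.
(* Read off from 1 = M^-1 M = M^-1 + M^-1 X S_1. *)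
exists (- (invmx M *m X)).
have : invmx M *m M = 1%:M by rewrite mulVmx.
rewrite {2}eX mulmxDr mulmx1 mulNmx -mulmxA => <-.
by rewrite mulmxA addrK.
Qed.

Lemma eichler_disc_kernel (u v : 'cV[int]_(dim1 n)) (q : int) :
  bf (S1 S) u u = 0 -> bf (S1 S) u v = 0 -> bf (S1 S) v v = 2 * q ->
  G (eichler (S1 S) u v q 1).
Proof.
move=> uu uv vv; split; last by exists (eichlerX u v q 1).
rewrite /Gamma /= inF_eichler.
have E x y : bf (inF R (S1 S)) (inF R x) (inF R y) = (bf (S1 S) x y)%:~R by rewrite map_bf.
apply: orthoR_plus_eichler; rewrite ?E ?uu ?uv ?vv//; last by rewrite intrM.
exact: symS.
Qed.

Definition transl (g g' : 'cV[rat]_(dim1 n)) : Prop := exists2 M, G M & inF rat M *m g = g'.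

Lemma transl_trans g2 g1 g3 : transl g1 g2 -> transl g2 g3 -> transl g1 g3.
Proof.
move=> [M gM <-] [N gN <-]; exists (N *m M); first exact: disc_kernelM.
by rewrite inF_mul mulmxA.
Qed.

Lemma transl_eichler (u v : 'cV[int]_(dim1 n)) (q : int) g :
  bf (S1 S) u u = 0 -> bf (S1 S) u v = 0 -> bf (S1 S) v v = 2 * q ->
  transl g (g + bf (inF rat (S1 S)) (inF rat u) g *: inF rat v
     - bf (inF rat (S1 S)) (inF rat v) g *: inF rat u
     - (q%:~R * bf (inF rat (S1 S)) (inF rat u) g) *: inF rat u).
Proof.
move=> uu uv vv; exists (eichler (S1 S) u v q 1); first exact: eichler_disc_kernel.
by rewrite inF_eichler eichler_mul !expr1n !mul1r.
Qed.

(** Cross terms occur twice by symmetry, so parity is decided by the diagonal of S. This makes Q(v)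
    an integer, as the parameter of an integral Eichler transformation must be. *)
Lemma even_bf (v : 'cV[int]_n) : exists q : int, bf S v v = 2 * q.
Proof.
have sS := symS; have evS : forall i, (2 %| S i i)%Z by case: hS.
pose P (v : 'cV[int]_n) := exists q : int, bf S v v = 2 * q.
rewrite -/(P v) (matrix_sum_delta v); apply: (big_ind P) => [|x y [a ha] [b hb]|i _].
- by exists 0; rewrite bf0l mulr0.
- by exists (a + b + bf S x y); rewrite bfDl !bfDr ha hb (bfC y x sS); ring.
rewrite big_ord1 /P bfZl bfZr bf_delta; have /dvdzP[k ->] := evS i.
by exists (v i 0 * v i 0 * k); ring.
Qed.

(** * Eichler's criterion in coordinates *)

Section Orbit.
Context (c0 : 'cV[rat]_n) (s0 : 'cV[int]_n) (Qc0 : int).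
Hypotheses (Sc0 : inF rat S *m c0 = inF rat s0)
  (Qc0E : qform (inF rat S) c0 = Qc0%:~R).

(** Integral coordinates on L_1 + c: since Q(c0) is an integer, only the block c0 of c can fail to
    be integral. *)
Definition cvec (d p : int) (l : 'cV[int]_n) (q g : int) : 'cV[rat]_(dim1 n) :=
  mk5 d%:~R p%:~R (inF rat l + c0) q%:~R g%:~R.

(* The integral vector [S (l + c0)]. *)
Definition dualS (l : 'cV[int]_n) : 'cV[int]_n := S *m l + s0.

Lemma cusp_vecE : cusp_vec S c0 = cvec 1 0 0 0 Qc0.
Proof.
rewrite /cusp_vec /cvec /mk5 /cx /ctilde -Qc0E !mulr0z /inF map_mx0 add0r.
by rewrite !raddf0.
Qed.

Definition dotZ (v w : 'cV[int]_n) : int := (v^T *m w) 0 0.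

Lemma inF_dualS l : inF rat (dualS l) = inF rat S *m (inF rat l + c0).
Proof. by rewrite mulmxDr Sc0 -inF_mul /dualS /inF map_mxD. Qed.

Lemma bf_inF_dual (v l : 'cV[int]_n) :
  bf (inF rat S) (inF rat v) (inF rat l + c0) = (dotZ v (dualS l))%:~R.
Proof. by rewrite /bf -mulmxA -inF_dualS /inF map_trmx -map_mxM mxE. Qed.

(** One Eichler transformation written out, with x = (u, g)_1, y = (v, g)_1 and e = Q_1(v). The
    vector u has no component along S. All elementary moves are instances. *)
Lemma transl_cvec (ud up uq ug vd vp : int) v (vq vg e x y d p : int) l (q g d' p' : int) l'
    (q' g' : int) :
  ud * ug + ug * ud + up * uq + uq * up = 0 -> ud * vg + ug * vd + up * vq + uq * vp = 0 ->
  vd * vg + vg * vd + vp * vq + vq * vp - bf S v v = 2 * e ->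
  x = ud * g + ug * d + up * q + uq * p ->
  y = vd * g + vg * d + vp * q + vq * p - dotZ v (dualS l) ->
  d' = d + x * vd - y * ud - e * x * ud -> p' = p + x * vp - y * up - e * x * up ->
  l' = l + x *: v -> q' = q + x * vq - y * uq - e * x * uq ->
  g' = g + x * vg - y * ug - e * x * ug ->
  transl (cvec d p l q g) (cvec d' p' l' q' g').
Proof.
move=> uu uv vv xE yE -> -> -> -> ->.
have inFint a b (A : 'M[int]_(a, b)) : inF int A = A.
  by apply/matrixP => i j; rewrite mxE intz.
have E (a a' b b' c c' f f' : int) (m m' : 'cV[int]_n) :
    bf (S1 S) (mk5 a b m c f) (mk5 a' b' m' c' f') =
    a * f' + f * a' + b * c' + c * b' - bf S m m'.
  by have := @bf_S1 int n S a b m c f a' b' m' c' f'; rewrite !inFint.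
have := @transl_eichler (mk5 ud up 0 uq ug) (mk5 vd vp v vq vg) e (cvec d p l q g).
rewrite !E !bf0l !subr0 uu uv vv => /(_ erefl erefl erefl).
rewrite !inF_mk5 [inF rat 0]map_mx0 /cvec !bf_S1 bf0l subr0 bf_inF_dual.
rewrite -!scaleNr !mk5Z !mk5D !scaler0 !addr0.
rewrite (_ : ud%:~R * g%:~R + _ + _ + _ = x%:~R); last first.
  by rewrite xE !(rmorphD, rmorphM).
rewrite (_ : vd%:~R * g%:~R + _ + _ + _ - _ = y%:~R); last first.
  by rewrite yE !(rmorphB, rmorphD, rmorphM).
rewrite (_ : inF rat l + c0 + _ = inF rat (l + x *: v) + c0); last first.
  by rewrite addrAC /inF map_mxD map_mxZ.
by rewrite !mulNr !(rmorphB, rmorphD, rmorphM).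
Qed.

(* The elementary moves are the Eichler transformations with [u], [v] among the
   hyperbolic basis vectors, or with [v] in the lattice of [S]. *)
Lemma move_dq t d p l q g : transl (cvec d p l q g) (cvec (d + t * p) p l (q - t * g) g).
Proof.
apply: (@transl_cvec 1 0 0 0 0 0 0 (- t) 0 0 g (- t * p));
  rewrite /dotZ ?trmx0 ?mul0mx ?mxE ?bf0l ?scaler0 ?addr0//; ring.
Qed.

Lemma move_dp t d p l q g : transl (cvec d p l q g) (cvec (d + t * q) (p - t * g) l q g).
Proof.
apply: (@transl_cvec 1 0 0 0 0 (- t) 0 0 0 0 g (- t * q));
  rewrite /dotZ ?trmx0 ?mul0mx ?mxE ?bf0l ?scaler0 ?addr0//; ring.
Qed.

Lemma move_gq t d p l q g : transl (cvec d p l q g) (cvec d p l (q - t * d) (g + t * p)).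
Proof.
apply: (@transl_cvec 0 0 0 1 0 0 0 (- t) 0 0 d (- t * p));
  rewrite /dotZ ?trmx0 ?mul0mx ?mxE ?bf0l ?scaler0 ?addr0//; ring.
Qed.

Lemma move_gp t d p l q g : transl (cvec d p l q g) (cvec d (p - t * d) l q (g + t * q)).
Proof.
apply: (@transl_cvec 0 0 0 1 0 (- t) 0 0 0 0 d (- t * q));
  rewrite /dotZ ?trmx0 ?mul0mx ?mxE ?bf0l ?scaler0 ?addr0//; ring.
Qed.

(** The last entry is left unspecified, because isotropy determines it once the others are
    normalized. *)
Lemma move_gl v d p l q g : exists g', transl (cvec d p l q g) (cvec d p (l + d *: v) q g').
Proof.
have [e he] := even_bf v; exists (g + dotZ v (dualS l) + e * d).
by apply: (@transl_cvec 0 0 0 1 0 0 v 0 0 (- e) d (- dotZ v (dualS l))); rewrite ?he//; ring.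
Qed.

(** With u the basis vector of the entry p one has x = q, so q = 0 freezes l and only the pairing of
    v with S (l + c0) is added to p. *)
Lemma move_pl v d p l g : transl (cvec d p l 0 g) (cvec d (p + dotZ v (dualS l)) l 0 g).
Proof.
have [e he] := even_bf v.
apply: (@transl_cvec 0 1 0 0 0 0 v 0 0 (- e) 0 (- dotZ v (dualS l)));
  rewrite ?he ?scale0r ?addr0//; ring.
Qed.

(** Primitivity of S_1 g in the form used by the descent: the block S (l + c0) is tested through its
    pairings with all v, exactly the amounts that [move_pl] adds to p. *)
Definition entry_gcd (l : 'cV[int]_n) (d p q g : int) : Prop :=
  forall k : int, (forall v, (k %| dotZ v (dualS l))%Z) ->
    (k %| d)%Z -> (k %| p)%Z -> (k %| q)%Z -> (k %| g)%Z -> `|k| = 1.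

Lemma S1_cvec d p l q g : inF rat (S1 S) *m cvec d p l q g = inF rat (mk5 g q (- dualS l) p d).
Proof. by rewrite /cvec S1_mk5 inF_mk5 -inF_dualS /inF map_mxN. Qed.

Lemma vgcd_inF m (W : 'cV[int]_m) : vgcd (inF rat W) = \big[gcdn/0%N]_i absz (W i 0).
Proof. by apply: eq_bigr => i _; rewrite mxE numq_int. Qed.

Lemma vgcd_dvd m (W : 'cV[int]_m) (k : int) :
  (forall i, (k %| W i 0%R)%Z) <-> (absz k %| vgcd (inF rat W))%N.
Proof.
rewrite vgcd_inF; split=> [h|/dvdn_biggcdP h i]; first by apply/dvdn_biggcdP => i _; exact: h.
exact: h.
Qed.

Lemma vgcd_mul m r (K : 'M[int]_(r, m)) (W : 'cV[int]_m) :
  vgcd (inF rat (K *m W)) = 1%N -> vgcd (inF rat W) = 1%N.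
Proof.
move=> h; apply/eqP; rewrite -dvdn1.
suff : (absz (Posz (vgcd (inF rat W))) %| vgcd (inF rat (K *m W)))%N by rewrite h.
have D := (vgcd_dvd W (Posz (vgcd (inF rat W)))).2 (dvdnn _).
apply/vgcd_dvd => i; rewrite mxE; apply: (big_ind (fun x => (_ %| x)%Z)) => [|x y|j _].
- exact: dvdz0.
- exact: rpredD.
- exact: dvdz_mull (D j).
Qed.

Lemma vgcd_entry l d p q g :
  vgcd (inF rat (S1 S) *m cvec d p l q g) = 1%N -> entry_gcd l d p q g.
Proof.
rewrite S1_cvec => h k kv kd kp kq kg.
suff : (absz k %| 1)%N by rewrite dvdn1 => /eqP hk; rewrite -abszE hk.
rewrite -h; apply/vgcd_dvd => i.
have kl j : (k %| (dualS l) j 0%R)%Z.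
  by have := kv (delta_mx j 0); rewrite /dotZ trmx_delta -rowE mxE.
rewrite /mk5 /cx; case: (split_ordP i) => j ->; rewrite ?col_mxEu ?col_mxEd.
  by rewrite mxE ord1 eqxx mulr1n.
case: (split_ordP j) => {}j ->; rewrite ?col_mxEu ?col_mxEd; last first.
  by rewrite mxE ord1 eqxx mulr1n.
case: (split_ordP j) => {}j ->; rewrite ?col_mxEu ?col_mxEd.
  by rewrite mxE ord1 eqxx mulr1n.
case: (split_ordP j) => {}j ->; rewrite ?col_mxEu ?col_mxEd.
  by rewrite mxE rpredN.
by rewrite mxE ord1 eqxx mulr1n.
Qed.

Lemma prim_mul M g : G M -> prim_isotropic S c0 g -> prim_isotropic S c0 (inF rat M *m g).
Proof.
move=> gM [[l gE] g1 Qg].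
have oM := disc_kernel_ortho gM; case: (gM) => _ [X eX].
have [W eW] : exists W : 'cV[int]_(dim1 n), inF rat (S1 S) *m g = inF rat W.
  rewrite gE cusp_vecE mulmxDr S1_cvec -inF_mul -inFD.
  by eexists.
split.
(* M g = g + X S_1 g, and S_1 g is integral; this is how the discriminant kernel preserves L_1 +
   c. *)
- exists (l + X *m W); rewrite eX [inF rat (1%:M + _)]inFD !inF_mul inF1 mulmxDl mul1mx.
  by rewrite inFD inF_mul -eW addrAC -gE mulmxA.
(* S_1 M g is integral because S_1 M = M^-tr S_1, and M^tr maps it back to S_1 g; hence its gcd
   divides that of S_1 g. *)
- have [W' eW'] : exists W' : 'cV[int]_(dim1 n), inF rat (S1 S) *m (inF rat M *m g) = inF rat W'.
    exists ((invmx M)^T *m W); rewrite inF_mul -eW -{2}oM !inF_mul !mulmxA.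
    by rewrite -[inF rat _ *m inF rat M^T]inF_mul -trmx_mul mulmxV ?disc_kernel_unit// trmx1 /inF map_mx1 mul1mx.
  rewrite eW'; apply: (@vgcd_mul _ _ M^T); rewrite inF_mul -eW' !mulmxA -!inF_mul oM.
  exact: g1.
- rewrite -[LHS]/(_ * bf _ _ _) bf_mul inF_ortho//.
Qed.

Lemma prim_transl g g' : transl g g' -> prim_isotropic S c0 g -> prim_isotropic S c0 g'.
Proof. by move=> [M gM <-]; exact: prim_mul. Qed.

Lemma isotropic_cvec d p l q g :
  qform (inF rat (S1 S)) (cvec d p l q g) = 0 ->
  2 * (d%:~R * g%:~R + p%:~R * q%:~R) = bf (inF rat S) (inF rat l + c0) (inF rat l + c0).
Proof.
rewrite /qform => /eqP; rewrite mulf_eq0 invr_eq0 pnatr_eq0/= -[X in X == 0]/(bf _ _ _).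
by rewrite bf_S1 subr_eq0 => /eqP <-; ring.
Qed.

(** With d = 1 the entries p, q and l are cleared in turn, and isotropy forces the last entry to be
    Q(c0). *)
Lemma unit_transl p l q g :
  prim_isotropic S c0 (cvec 1 p l q g) -> transl (cvec 1 p l q g) (cusp_vec S c0).
Proof.
move=> pr; apply: (transl_trans (move_gp p _ _ _ _ _)).
apply: (transl_trans (move_gq q _ _ _ _ _)); rewrite !mulr1 !subrr.
have [g' h] := move_gl (- l) 1 0 l 0 (g + p * q + q * 0).
rewrite scale1r subrr in h.
have {}pr : prim_isotropic S c0 (cvec 1 0 0 0 g').
  apply: prim_transl h _.
  have := prim_transl (move_gp p _ _ _ _ _) pr; rewrite mulr1 subrr.
  by move/(prim_transl (move_gq q _ _ _ _ _)); rewrite mulr1 subrr.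
rewrite cusp_vecE (_ : Qc0 = g')//.
case: pr => _ _ /isotropic_cvec; rewrite [inF rat 0]map_mx0 add0r mulr0 addr0 mul1r => e.
apply: (@intr_inj rat); rewrite -Qc0E /qform -[X in _ * X]/(bf _ _ _) -e mulKf//.
Qed.

(* Descent on [|d|]: Euclidean division lowers [|d|] as soon as some entry reachable in
   the position of [p] or [q] is not a multiple of [d]; otherwise [d] divides all entries
   of the primitive vector [S_1 g], so that [d] is a unit. *)
Lemma prim_transl_cusp N d p l q g : (absz d <= N)%N -> d != 0 ->
  prim_isotropic S c0 (cvec d p l q g) -> transl (cvec d p l q g) (cusp_vec S c0).
Proof.
elim: N d p l q g => [|N IH] d p l q g; first by lia.
move=> dN d0 pr.
have redp p' l' q' g' : prim_isotropic S c0 (cvec d p' l' q' g') -> ~~ (d %| p')%Z ->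
    transl (cvec d p' l' q' g') (cusp_vec S c0).
  move=> pr' ndv; have := modz_ge0 p' d0; have := ltz_mod p' d0.
  set r := (p' %% d)%Z => r1 r2.
  have r0 : r != 0 by rewrite /r; apply: contra ndv => /eqP/dvdz_mod0P.
  have h1 := move_gp (p' %/ d)%Z d p' l' q' g'.
  (* The sign is chosen so that d moves towards zero by r; since 0 < r < |d|, it gets smaller
     without vanishing. *)
  have h2 := move_dq (if 0 < d then -1 else 1) d (p' - (p' %/ d)%Z * d) l' q' (g' + (p' %/ d)%Z * q').
  have rE : p' - (p' %/ d)%Z * d = r by rewrite /r /modz.
  rewrite rE in h1 h2.
  apply: transl_trans h1 _; apply: transl_trans (h2) _; apply: IH.
  - by case: ifP => h; lia.
  - by case: ifP => h; lia.
  - by apply: prim_transl h2 _; rewrite -rE; apply: prim_transl pr'; exact: move_gp.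
have redq p' l' q' g' : prim_isotropic S c0 (cvec d p' l' q' g') -> ~~ (d %| q')%Z ->
    transl (cvec d p' l' q' g') (cusp_vec S c0).
  move=> pr' ndv; have := modz_ge0 q' d0; have := ltz_mod q' d0.
  set r := (q' %% d)%Z => r1 r2.
  have r0 : r != 0 by rewrite /r; apply: contra ndv => /eqP/dvdz_mod0P.
  have h1 := move_gq (q' %/ d)%Z d p' l' q' g'.
  have h2 := move_dp (if 0 < d then -1 else 1) d p' l' (q' - (q' %/ d)%Z * d) (g' + (q' %/ d)%Z * p').
  have rE : q' - (q' %/ d)%Z * d = r by rewrite /r /modz.
  rewrite rE in h1 h2.
  apply: transl_trans h1 _; apply: transl_trans (h2) _; apply: IH.
  - by case: ifP => h; lia.
  - by case: ifP => h; lia.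
  - by apply: prim_transl h2 _; rewrite -rE; apply: prim_transl pr'; exact: move_gq.
have [dp|dp] := boolP (d %| p)%Z; last exact: redp.
have [dq|dq] := boolP (d %| q)%Z; last exact: redq.
have h1 := move_gp (p %/ d)%Z d p l q g; rewrite divzK// subrr in h1.
set g1 := g + _ in h1; apply: transl_trans (h1) _; have {h1}pr := prim_transl h1 pr.
have h2 := move_gq (q %/ d)%Z d 0 l q g1; rewrite divzK// subrr in h2.
set g2 := g1 + _ in h2; apply: transl_trans (h2) _; have {h2}pr := prim_transl h2 pr.
(* Now p = q = 0, so a pairing of S (l + c0) that is not a multiple of d can be placed at p. *)
have [dv|] := pselect (forall v, (d %| dotZ v (dualS l))%Z); last first.
  move=> /existsNP[v /negP ndv]; have h := move_pl v d 0 l g2; rewrite add0r in h.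
  by apply: transl_trans (h) _; apply: redp => //; exact: prim_transl h pr.
have [dg|ndg] := boolP (d %| g2)%Z; last first.
  (* As q = 0, this puts -g at p without changing d. *)
  have h := move_dp 1 d 0 l 0 g2; rewrite mulr0 addr0 mul1r sub0r in h.
  apply: transl_trans (h) _; apply: redp; last by rewrite rpredN.
  exact: prim_transl h pr.
have d1 : `|d| = 1.
  by case: (pr) => _ /vgcd_entry/(_ d dv (dvdzz d) (dvdz0 d) (dvdz0 d) dg).
have [dE|dE] : d = 1 \/ d = -1 by lia.
  by rewrite dE in pr *; exact: unit_transl.
rewrite dE in pr *.
(* The sign is repaired by placing 2 at p and then adding it to d: -1 + 2 = 1. *)
have h3 := move_gp 2 (-1) 0 l 0 g2.
apply: transl_trans (h3) _; have {h3}pr := prim_transl h3 pr.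
rewrite (_ : 0 - 2 * -1 = 2) in pr *; last by ring.
rewrite (_ : g2 + 2 * 0 = g2) in pr *; last by ring.
have h4 := move_dq 1 (-1) 2 l 0 g2.
apply: transl_trans (h4) _; have {h4}pr := prim_transl h4 pr.
by rewrite (_ : -1 + 1 * 2 = 1) in pr *; [exact: unit_transl|ring].
Qed.

(** Isotropy reduces to the vanishing of S at l + c0, so l + c0 = 0 by definiteness; then S_1 g = 0
    is divisible by 2, against primitivity. *)
Lemma prim_nonzero l : ~ prim_isotropic S c0 (cvec 0 0 l 0 0).
Proof.
case=> _ /vgcd_entry H /isotropic_cvec.
rewrite !(mulr0z, mulr0, addr0) => e.
suff l0 : dualS l = 0.
  have := H 2; rewrite !dvdz0 => /(_ _ isT isT isT isT).
  have h2 v : (2 %| dotZ v (dualS l))%Z by rewrite l0 /dotZ mulmx0 mxE.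
  by move=> /(_ h2).
apply: (@inF_inj rat); rewrite inF_dualS [RHS]map_mx0.
suff -> : inF rat l + c0 = 0 by rewrite mulmx0.
apply/eqP; apply: contraT => v0; have := @S_pos (map_mx ratr (inF rat l + c0)).
have := congr1 (@ratr R) e; rewrite map_bf rmorph0 map_ratr_inF => <-.
by rewrite map_mx_eq0 ltxx => /(_ v0).
Qed.

(** What remains is to make d nonzero: a nonzero q or p is added to d, and a nonzero last entry is
    first moved to p. *)
Lemma prim_transl_cusp_vec g : prim_isotropic S c0 g -> transl g (cusp_vec S c0).
Proof.
move=> pr; have [[L gE] _ _] := pr.
have [d [p [l [q [h LE]]]]] := mk5_surj L.
have {gE L LE} gE : g = cvec (d + 1) p l q (h + Qc0).
  rewrite gE LE cusp_vecE inF_mk5 /cvec mk5D [inF rat 0]map_mx0 !rmorphD /= !addr0.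
  by rewrite add0r.
move: (d + 1) (h + Qc0) gE => {}d {h}g' gE; rewrite gE in pr *.
have nz d' p' q' g2 : prim_isotropic S c0 (cvec d' p' l q' g2) -> d' != 0 ->
   transl (cvec d' p' l q' g2) (cusp_vec S c0).
  by move=> pr' d'0; exact: (prim_transl_cusp (leqnn _) d'0 pr').
have nzq d' p' q' g2 : prim_isotropic S c0 (cvec d' p' l q' g2) -> q' != 0 ->
   transl (cvec d' p' l q' g2) (cusp_vec S c0).
  move=> pr' q0; have [d'0|] := eqVneq d' 0; last exact: nz.
  have m := move_dp 1 d' p' l q' g2; apply: transl_trans (m) _; apply: nz.
    exact: prim_transl m pr'.
  by rewrite d'0 add0r mul1r.
have [d0|] := eqVneq d 0; last exact: nz.
have [q0|] := eqVneq q 0; last exact: nzq.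
have nzp p' q' g2 : prim_isotropic S c0 (cvec d p' l q' g2) -> p' != 0 ->
   transl (cvec d p' l q' g2) (cusp_vec S c0).
  move=> pr' p0.
  have m := move_dq 1 d p' l q' g2; apply: transl_trans (m) _; apply: nz.
    exact: prim_transl m pr'.
  by rewrite d0 add0r mul1r.
have [p0|] := eqVneq p 0; last exact: nzp.
have [g0|gn] := eqVneq g' 0; last first.
  have m := move_dp 1 d p l q g'; apply: transl_trans (m) _.
  rewrite (_ : d + 1 * q = d) in m *; last by rewrite q0 mulr0 addr0.
  apply: nzp; first exact: prim_transl m pr.
  by rewrite p0 sub0r mul1r oppr_eq0.
by exfalso; rewrite d0 p0 q0 g0 in pr; exact: prim_nonzero pr.
Qed.

Lemma prim_cusp_vec : prim_isotropic S c0 (cusp_vec S c0).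
Proof.
split.
- by exists 0; rewrite /inF map_mx0 add0r.
- rewrite cusp_vecE S1_cvec; apply/eqP; rewrite -dvdn1 -[X in (_ %| X)%N]/(absz 1%:Z).
  have D := (vgcd_dvd (mk5 Qc0 0 (- dualS 0) 0 1) (Posz (vgcd (inF rat (mk5 Qc0 0 (- dualS 0) 0 1))))).2 (dvdnn _).
  have := D (rshift 1 (rshift (dim0 n) 0)).
  by rewrite /mk5 /cx !col_mxEd mxE mulr1n.
- rewrite cusp_vecE /qform -[X in _ * X]/(bf _ _ _) /cvec bf_S1 [inF rat 0]map_mx0 add0r.
  have -> : bf (inF rat S) c0 c0 = 2 * Qc0%:~R.
    by rewrite -Qc0E /qform mulrA divff ?mul1r// pnatr_eq0.
  by rewrite !(mulr0z, mulr0, addr0) mulr1 mul1r; ring.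
Qed.

Lemma ctilde_form : bf (inF rat (S0 S)) (ctilde c0) (ctilde c0) = - (2 * Qc0%:~R).
Proof.
rewrite (_ : ctilde c0 = cx 0 c0 0); last by rewrite /ctilde /cx !raddf0.
rewrite bf_S0 mulr0 addr0 sub0r -Qc0E /qform mulrA divff ?mul1r// pnatr_eq0.
Qed.

Lemma Ttilde_cx a (v : 'cV[rat]_(dim0 n)) b : Ttilde S c0 *m cx a v b =
  cx a (a *: ctilde c0 + v) (a * Qc0%:~R - bf (inF rat (S0 S)) (ctilde c0) v + b).
Proof.
rewrite /Ttilde /cx Qc0E mul_block_col mul1mx mul0mx addr0; congr col_mx.
rewrite mul_col_mx mul_block_col mul0mx !mul1mx addr0 mulNmx add_col_mx.
rewrite mul_mx_scalar -scalar_mxM; congr col_mx.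
rewrite [(ctilde c0)^T *m _ *m v]mx11_scalar [RHS]raddfD raddfB /=.
by rewrite mulrC addrA.
Qed.

Lemma Ttilde_ortho : (Ttilde S c0)^T *m inF rat (S1 S) *m Ttilde S c0 = inF rat (S1 S).
Proof.
apply: bf_ext => x y; rewrite -bf_mul.
have [a [v [b ->]]] := cx_surj x; have [a' [v' [b' ->]]] := cx_surj y.
rewrite !Ttilde_cx inF_S1 !bf_hyp_ext !(bfDl, bfDr, bfZl, bfZr) ctilde_form.
rewrite (bfC v (ctilde c0) (tr_inF_S0 _ symS)); ring.
Qed.

Lemma Ttilde_cusp : Ttilde S c0 *m cx 1 0 0 = cusp_vec S c0.
Proof. by rewrite Ttilde_cx scale1r addr0 bf0r subr0 addr0 mul1r /cusp_vec Qc0E. Qed.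

Lemma Ttilde_unit : Ttilde S c0 \in unitmx.
Proof.
rewrite unitmxE unitfE /Ttilde det_lblock det1 mul1r.
by rewrite (@det_lblock _ (dim0 n) 1) !det1 mulr1 oner_eq0.
Qed.

(** * Cosets of the stabilizer and the orbit of c *)

Definition orbit_vec (A : set 'M[int]_(dim1 n)) : 'cV[rat]_(dim1 n) :=
  inF rat (invmx (xget 1%:M A)) *m cusp_vec S c0.

Lemma coset_repr M : G M -> exists2 N, disc_stab R S c0 N &
  xget 1%:M [set N *m M | N in disc_stab R S c0] = N *m M.
Proof.
move=> gM; case: (xgetP 1%:M [set N *m M | N in disc_stab R S c0]) => [_ -> [N sN <-]|].
  by exists N.
move=> /(_ M) []; exists 1%:M; last by rewrite mul1mx.
by split; [exact: disc_kernel1|rewrite inF1 mul1mx].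
Qed.

Lemma invmx_mul (M N : 'M[int]_(dim1 n)) : M \in unitmx -> N \in unitmx ->
  invmx (N *m M) = invmx M *m invmx N.
Proof.
move=> uM uN; have uNM : N *m M \in unitmx by rewrite unitmx_mul uN.
by rewrite -[RHS](mulmxK uNM) -(mulmxA _ (invmx N)) (mulmxA (invmx N)) mulVmx// mul1mx mulVmx// mul1mx.
Qed.

Lemma disc_stabV N : disc_stab R S c0 N ->
  inF rat (invmx N) *m cusp_vec S c0 = cusp_vec S c0.
Proof.
move=> [gN e]; rewrite -{1}e mulmxA -inF_mul mulVmx ?inF1 ?mul1mx//.
exact: disc_kernel_unit.
Qed.

(** The representative picked by [xget] is N M with N fixing c, and N^-1 then fixes c too. *)
Lemma orbit_vecE M : G M ->
  orbit_vec [set N *m M | N in disc_stab R S c0] = inF rat (invmx M) *m cusp_vec S c0.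
Proof.
move=> gM; have [N sN e] := coset_repr gM; rewrite /orbit_vec e.
have uM := disc_kernel_unit gM; have uN := disc_kernel_unit sN.1.
by rewrite invmx_mul// inF_mul -mulmxA disc_stabV.
Qed.

Lemma orbit_vec_bij : set_bij (cosets R S c0) (prim_isotropic S c0) orbit_vec.
Proof.
split.
- move=> A [M gM <-]; rewrite orbit_vecE//.
  by apply: prim_mul; [exact: disc_kernelV|exact: prim_cusp_vec].
- move=> A B /set_mem[M gM <-] /set_mem[N gN <-].
  have uM := disc_kernel_unit gM; have uN := disc_kernel_unit gN.
  rewrite !orbit_vecE// => e.
  have sub M1 N1 : G M1 -> G N1 ->
      inF rat (invmx M1) *m cusp_vec S c0 = inF rat (invmx N1) *m cusp_vec S c0 ->
      [set N *m M1 | N in disc_stab R S c0] `<=` [set N *m N1 | N in disc_stab R S c0].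
    move=> gM1 gN1 e1 _ [P [gP eP] <-].
    have uM1 := disc_kernel_unit gM1; have uN1 := disc_kernel_unit gN1.
    exists (P *m M1 *m invmx N1); last by rewrite mulmxKV.
    split; first by apply: disc_kernelM; [exact: disc_kernelM|exact: disc_kernelV].
    rewrite !inF_mul -!mulmxA -e1 (mulmxA (inF rat M1)) -inF_mul mulmxV//.
    by rewrite inF1 mul1mx.
  by apply/seteqP; split; apply: sub.
- move=> g /[dup] pr /prim_transl_cusp_vec[M gM e].
  exists [set N *m M | N in disc_stab R S c0]; first by exists M.
  rewrite orbit_vecE// -e mulmxA -inF_mul mulVmx ?inF1 ?mul1mx//.
  exact: disc_kernel_unit.
Qed.

(** * Automorphy factors as pairings with an isotropic vector *)

Notation C := R[i].

(* [w(z) = (-Q_0(z), z, 1)] is isotropic, [j(g, z) = (g, w(z))_1], and [j(M, z)] is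
   the last entry of [M w(z)]. *)
Definition wvec (z : 'cV[C]_(dim0 n)) : 'cV[C]_(dim1 n) := cx (- Q0 S z) z 1.

Lemma Q0E (z : 'cV[C]_(dim0 n)) : bf (inF C (S0 S)) z z = 2 * Q0 S z.
Proof. by rewrite /Q0 /qform mulrA divff ?mul1r// pnatr_eq0. Qed.

Lemma wvec_iso z : bf (inF C (S1 S)) (wvec z) (wvec z) = 0.
Proof. by rewrite inF_S1 bf_hyp_ext Q0E; ring. Qed.

Lemma jvecE g (z : 'cV[C]_(dim0 n)) :
  jvec S g z = bf (inF C (S1 S)) (map_mx ratr g) (wvec z).
Proof.
have [a [v [b ->]]] := cx_surj g.
rewrite map_cx inF_S1 bf_hyp_ext /jvec /cx col_mxKu !col_mxKd col_mxKu.
by rewrite -[bil _ _ _]/(bf _ _ _) !mxE !mulr1n mulr1 mulrN mulNr; ring.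
Qed.

Definition last_entry (x : 'cV[C]_(dim1 n)) : C := dsubmx (dsubmx x) 0 0.

Lemma last_entry_cx a v b : last_entry (cx a v b) = b.
Proof. by rewrite /last_entry /cx !col_mxKd mxE mulr1n. Qed.

Lemma last_entry_bf x : last_entry x = bf (inF C (S1 S)) (cx 1 0 0) x.
Proof.
have [a [v [b ->]]] := cx_surj x.
by rewrite last_entry_cx inF_S1 bf_hyp_ext bf0l mul0r mul1r !addr0.
Qed.

Lemma mul_wvec (M : 'M[C]_(dim1 n)) z :
  dsubmx (M *m wvec z) = col_mx (- Q0 S z *: usubmx (dlsubmx M) +
     ulsubmx (drsubmx M) *m z + ursubmx (drsubmx M)) (jM S M z)%:M.
Proof.
rewrite -{1}[M]submxK /wvec /cx mul_block_col col_mxKd.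
rewrite -{1}[drsubmx M]submxK mul_block_col -{1}[dlsubmx M]vsubmxK mul_col_mx add_col_mx.
rewrite !mulmx1 mul_mx_scalar addrA; congr col_mx.
rewrite [LHS]mx11_scalar /jM; congr (_%:M).
by rewrite mul_mx_scalar !mxE addrA !mulNr [Q0 S z * _]mulrC.
Qed.

Lemma jM_last M z : jM S M z = last_entry (M *m wvec z).
Proof. by rewrite /last_entry mul_wvec col_mxKd mxE mulr1n. Qed.

Lemma act_mid M z : act S M z = (jM S M z)^-1 *: usubmx (dsubmx (M *m wvec z)).
Proof. by rewrite mul_wvec col_mxKu. Qed.

(** The definitions of [act] and [jM] give the middle and last entries of M w(z); the first entry
    occurs in neither, and is forced by isotropy once j(M, z) is nonzero. *)
Lemma wvec_act (M : 'M[C]_(dim1 n)) z :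
  M^T *m inF C (S1 S) *m M = inF C (S1 S) -> jM S M z != 0 ->
  M *m wvec z = jM S M z *: wvec (act S M z).
Proof.
move=> oM j0; have := wvec_iso z; rewrite -[X in bf X]oM -bf_mul.
have := jM_last M z; have := act_mid M z.
have [a [v [b ->]]] := cx_surj (M *m wvec z).
rewrite last_entry_cx => aE jE; rewrite -jE in aE *.
rewrite {1}/cx col_mxKd col_mxKu in aE.
have -> : v = jM S M z *: act S M z by rewrite aE scalerA divff// scale1r.
rewrite inF_S1 bf_hyp_ext bfZl bfZr Q0E /wvec cxZ mulr1 => e.
congr cx; apply: (mulfI j0); apply: (@mulfI _ 2); first by rewrite pnatr_eq0.
by apply/eqP; rewrite -subr_eq0 -e; apply/eqP; ring.
Qed.

Lemma jvec_act M g z : G M -> jM S (inF C M) z != 0 ->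
  jvec S g (act S (inF C M) z) * jM S (inF C M) z = jvec S (inF rat (invmx M) *m g) z.
Proof.
move=> gM j0; have uM := disc_kernel_unit gM; have oM := disc_kernel_ortho gM.
have oMC := inF_ortho C oM.
have MM : inF C M *m inF C (invmx M) = 1%:M by rewrite -inF_mul mulmxV// inF1.
rewrite !jvecE mulrC -bfZr -wvec_act// -[in RHS]oMC -bf_mul map_mxM map_ratr_inF.
by rewrite mulmxA MM mul1mx.
Qed.

(** With T for [Ttilde], the last entry of T^-1 M w is (e_1, T^-1 M w)_1 = (T e_1, M w)_1 = (c, M
    w)_1 = (M^-1 c, w)_1, as T and M are both isometries. *)
Lemma eis_term_orbit k (z : 'cV[C]_(dim0 n)) A : cosets R S c0 A ->
  eis_term S c0 k z A = jvec S (orbit_vec A) z ^- k.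
Proof.
move=> [M0 gM0 <-]; have [N sN e] := coset_repr gM0.
rewrite /eis_term /orbit_vec e; set M := N *m M0.
have gM : G M by apply: disc_kernelM => //; exact: sN.1.
have uM := disc_kernel_unit gM; have oM := disc_kernel_ortho gM.
congr (_ ^- k); rewrite jM_last last_entry_bf jvecE.
set T := map_mx ratr (Ttilde S c0) : 'M[C]_(dim1 n).
have oT : T^T *m inF C (S1 S) *m T = inF C (S1 S).
  by rewrite -map_ratr_inF /T map_trmx -!map_mxM Ttilde_ortho.
rewrite -{1}oT -bf_mul.
have -> : T *m cx 1 0 0 = map_mx ratr (cusp_vec S c0).
  by rewrite -Ttilde_cusp map_mxM map_cx rmorph1 !rmorph0 map_mx0.
have TM : T *m map_mx ratr (invmx (Ttilde S c0) *m inF rat M) = inF C M.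
  by rewrite /T -map_mxM mulmxA mulmxV ?Ttilde_unit// mul1mx map_ratr_inF.
rewrite mulmxA TM.
have oMC := inF_ortho C oM.
have MM : inF C M *m inF C (invmx M) = 1%:M by rewrite -inF_mul mulmxV// inF1.
rewrite -[in RHS]oMC -bf_mul map_mxM map_ratr_inF.
by rewrite [in RHS]mulmxA MM mul1mx.
Qed.

End Orbit.
End Kernel.

(** * Bounding isotropic vectors by the automorphy factor *)

Section Dominated.
Context (R : realType) (T : Type) (P : set T) (N : T -> R).
Hypothesis N0 : forall t, 0 <= N t.

(** A big-O relation on P with anonymous constant, so that bounds can be combined linearly without
    carrying the constants along. *)
Definition dominated (f : T -> R) : Prop :=
  exists2 K, 0 <= K & forall t, P t -> `|f t| <= K * N t.

Lemma dominatedD f g : dominated f -> dominated g -> dominated (fun t => f t + g t).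
Proof.
move=> [K K0 hK] [L L0 hL]; exists (K + L) => [|t Pt]; first exact: addr_ge0.
by rewrite mulrDl; apply: le_trans (ler_normD _ _) _; rewrite lerD ?hK ?hL.
Qed.

Lemma dominatedZ c f : dominated f -> dominated (fun t => c * f t).
Proof.
move=> [K K0 hK]; exists (`|c| * K) => [|t Pt]; first by rewrite mulr_ge0.
by rewrite normrM -mulrA ler_wpM2l// hK.
Qed.

Lemma dominatedN f : dominated f -> dominated (fun t => - f t).
Proof. by move=> [K K0 hK]; exists K => // t /hK; rewrite normrN. Qed.

Lemma dominatedB f g : dominated f -> dominated g -> dominated (fun t => f t - g t).
Proof. by move=> hf hg; apply: dominatedD => //; exact: dominatedN. Qed.

Lemma dominated_sum (I : Type) (r : seq I) (f : I -> T -> R) :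
  (forall i, dominated (f i)) -> dominated (fun t => \sum_(i <- r) f i t).
Proof.
move=> hf; elim: r => [|i r [K K0 hK]].
  by exists 0 => // t _; rewrite big_nil normr0 mul0r.
have [L L0 hL] := hf i; exists (L + K) => [|t Pt]; first exact: addr_ge0.
by rewrite big_cons mulrDl; apply: le_trans (ler_normD _ _) _; rewrite lerD ?hK ?hL.
Qed.

(** The constant |c| + 1 replaces a square root: c <= (|c| + 1)^2 whatever the sign of c. *)
Lemma dominated_sqr f c : (forall t, P t -> f t ^+ 2 <= c * N t ^+ 2) -> dominated f.
Proof.
move=> h; exists (`|c| + 1) => [|t Pt]; first by rewrite addr_ge0.
have c0 := normr_ge0 c.
rewrite -(@ler_pXn2r _ 2) ?nnegrE ?mulr_ge0 ?addr_ge0//.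
rewrite real_normK ?num_real//; apply: le_trans (h t Pt) _.
rewrite exprMn ler_wpM2r ?sqr_ge0//; apply: le_trans (ler_norm c) _; nra.
Qed.

Lemma dominated_ext f g : (forall t, P t -> f t = g t) -> dominated f -> dominated g.
Proof. by move=> fg [K K0 hK]; exists K => // t Pt; rewrite -fg// hK. Qed.

End Dominated.

(** * Coordinates bounded by the positive definite form *)

Section PositiveForm.
Context (R : realType) (n : nat) (S : 'M[int]_n).
Hypothesis hS : even_posdef R S.
Notation b := (bf (inF R S)).

Lemma S_ge0 (x : 'cV[R]_n) : 0 <= b x x.
Proof. by have [->|/(S_pos hS)/ltW//] := eqVneq x 0; rewrite bf0l. Qed.

Lemma cauchy_schwarz (a x : 'cV[R]_n) : b a x ^+ 2 <= b a a * b x x.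
Proof.
have sR := tr_inF_S R (symS hS).
have [->|/(S_pos hS) a0] := eqVneq a 0; first by rewrite !bf0l expr0n mul0r.
have := S_ge0 (b a a *: x - b a x *: a).
rewrite !(bfDl, bfDr, bfNl, bfNr, bfZl, bfZr) (bfC x a sR) => h.
have {h} : 0 <= b a a * (b a a * b x x - b a x ^+ 2) by lra.
by rewrite pmulr_rge0// subr_ge0.
Qed.

(** The i-th coordinate is the pairing with S^-1 e_i, so Cauchy-Schwarz applies. *)
Lemma coord_le (i : 'I_n) : exists c : R, forall x : 'cV[R]_n, x i 0 ^+ 2 <= c * b x x.
Proof.
pose a := invmx (inF R S) *m (delta_mx i 0 : 'cV[R]_n); exists (b a a) => x.
suff -> : x i 0 = b a x by exact: cauchy_schwarz.
rewrite (bfC a x (tr_inF_S R (symS hS))) /bf -mulmxA /a mulKVmx.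
  by rewrite -colE !mxE.
exact: S_unit hS R.
Qed.

End PositiveForm.

Section LowerBound.
Context (R : realType) (n : nat) (S : 'M[int]_n).
Hypothesis hS : even_posdef R S.
Notation C := R[i].
Notation rc := (real_complex R).
Context (z : 'cV[C]_(dim0 n)).
Hypothesis hz : half_space S z.

Let x : 'cV[R]_(dim0 n) := map_mx (@complex.Re R) z.
Let y : 'cV[R]_(dim0 n) := map_mx (@complex.Im R) z.
Let b := bf (inF R S).
Let b0 := bf (inF R (S0 S)).
Let sR : (inF R S)^T = inF R S. Proof. exact: tr_inF_S (symS hS). Qed.
Let s0R : (inF R (S0 S))^T = inF R (S0 S). Proof. exact: tr_inF_S0 (symS hS). Qed.

Definition jreal (g : 'cV[R]_(dim1 n)) : C := bf (inF C (S1 S)) (map_mx rc g) (wvec S z).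

Definition isoR : set 'cV[R]_(dim1 n) := [set g | bf (inF R (S1 S)) g g = 0].

Lemma map_rc_inF m p (A : 'M[int]_(m, p)) : map_mx rc (inF R A) = inF C A.
Proof. by apply/matrixP => i j; rewrite !mxE rmorph_int. Qed.

Lemma zE : z = map_mx rc x + 'i%C *: map_mx rc y.
Proof. by apply/matrixP => i j; rewrite !mxE -complexE. Qed.

Lemma Q0_split : Q0 S z = rc (b0 x x / 2 - b0 y y / 2) + 'i%C * rc (b0 x y).
Proof.
apply: (@mulfI _ 2); first by rewrite pnatr_eq0.
rewrite -Q0E {1 2}zE !(bfDl, bfDr, bfZl, bfZr) -!map_rc_inF -!map_bf.
rewrite (bfC y x s0R) -/b0.
have i2 : 'i%C * 'i%C = -1 :> C by rewrite -expr2 sqr_i.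
have E (u v w : R) : rc u + 'i%C * rc v + ('i%C * rc v + 'i%C * ('i%C * rc w)) =
    2 * (rc (u / 2 - w / 2) + 'i%C * rc v).
  by rewrite ['i%C * ('i%C * _)]mulrA i2 rmorphB !rmorphM fmorphV rmorph_nat; field.
exact: E.
Qed.

Lemma jreal_split d0 (d : 'cV[R]_(dim0 n)) g :
  jreal (cx d0 d g) = rc (- g * (b0 x x / 2 - b0 y y / 2) + b0 d x + d0)
    + 'i%C * rc (b0 (d - g *: x) y).
Proof.
rewrite /jreal map_cx inF_S1 bf_hyp_ext mulr1 Q0_split zE bfDr bfZr -map_rc_inF -!map_bf.
rewrite /b0 bfDl bfNl bfZl -/b0 !(rmorphD, rmorphB, rmorphM, rmorphN) /=.
ring.
Qed.

(* With [e = d - g x] and [Y = Q_0(y) > 0], the form [(e, y)^2 / (2 Y) - Q_0(e)] is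
   positive definite; for an isotropic vector it equals [(Im j)^2 / (2 Y) + g Re j - g^2 Y],
   which bounds [g] and [e] by [|j|]. *)
Lemma isotropic_identity d0 (d : 'cV[R]_(dim0 n)) g :
  isoR (cx d0 d g) ->
  - (b0 (d - g *: x) (d - g *: x) / 2) =
    g * (- g * (b0 x x / 2 - b0 y y / 2) + b0 d x + d0) - g ^+ 2 * (b0 y y / 2).
Proof.
rewrite /isoR /= inF_S1 bf_hyp_ext -/(b0 _ _) => h.
rewrite /b0 !(bfDl, bfDr, bfNl, bfNr, bfZl, bfZr) (bfC x d s0R) -/b0.
have -> : b0 d d = - (2 * d0 * g) by lra.
by field.
Qed.

(** The isometry of Q_0 that takes y to (y1, 0, Y / y1) takes e to (e1, l', e2'), and in these
    coordinates the definite form is diagonal in e1 and e2' and splits off S. *)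
Lemma shear (y1 y2 e1 e2 : R) (v l : 'cV[R]_n) : y1 != 0 ->
  let Y := y1 * y2 - b v v / 2 in let l' := l - (e1 / y1) *: v in
  let e2' := e2 - b l v / y1 + e1 * (b v v) / (2 * y1 ^+ 2) in
  Y != 0 ->
  (b0 (cx e1 l e2) (cx y1 v y2)) ^+ 2 / (2 * Y) - b0 (cx e1 l e2) (cx e1 l e2) / 2 =
  (e1 ^+ 2 * Y / y1 ^+ 2 + e2' ^+ 2 * y1 ^+ 2 / Y + b l' l') / 2.
Proof.
move=> y10 Y l' e2' Y0.
rewrite /b0 !bf_S0 /l' /b !(bfDl, bfDr, bfNl, bfNr, bfZl, bfZr) (bfC v l sR) -/b.
rewrite /e2'; move: Y0; rewrite /Y; move: (b l v) (b v v) (b l l) => lv vv ll Y0.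
field; rewrite y10 /=; move: Y0; apply: contra => /eqP h; apply/eqP; lra.
Qed.

Notation N g := (nrm (jreal g)).
Notation dom := (dominated isoR (fun g => N g)).

Lemma jreal_dominated :
  [/\ dom (fun g => usubmx g 0 0), dom (fun g => dsubmx (dsubmx g) 0 0) &
     forall i, dom (fun g => usubmx (dsubmx g) i 0)].
Proof.
have N0 g : 0 <= N g by exact: nrm_ge0.
pose rj (g : 'cV[R]_(dim1 n)) := complex.Re (jreal g).
pose ij (g : 'cV[R]_(dim1 n)) := complex.Im (jreal g).
pose gm (g : 'cV[R]_(dim1 n)) : R := dsubmx (dsubmx g) 0 0.
pose dd (g : 'cV[R]_(dim1 n)) : 'cV[R]_(dim0 n) := usubmx (dsubmx g).
pose dl (g : 'cV[R]_(dim1 n)) : R := usubmx g 0 0.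
pose ee g := dd g - gm g *: x.
have [Y YD] : exists Y, Y = b0 y y / 2 by exists (b0 y y / 2).
have gE g : g = cx (dl g) (dd g) (gm g) by rewrite /cx -!mx11_scalar !vsubmxK.
have Y0 : 0 < Y by rewrite YD; case: hz; rewrite /qform mulrC.
have rjE g : rj g = - gm g * (b0 x x / 2 - Y) + b0 (dd g) x + dl g.
  by rewrite YD /rj (gE g) jreal_split /= !mul0r !mul1r !subr0 ?oppr0 ?addr0 -gE.
have ijE g : ij g = b0 (ee g) y.
  by rewrite /ij (gE g) jreal_split /= !mul0r !mul1r !add0r -gE.
have Nsq g : N g ^+ 2 = rj g ^+ 2 + ij g ^+ 2 by exact: sqr_nrm.
have [y1 [v [y2 yE]]] := cx_surj y.
have y1p : 0 < y1.
  by case: hz => _; rewrite -/y yE /cx col_mxKu mxE mulr1n.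
have YE : Y = y1 * y2 - b v v / 2.
  by rewrite YD yE /b0 bf_S0 /b; field.
pose e1 g := usubmx (ee g) 0 0.
pose l g := usubmx (dsubmx (ee g)).
pose e2 g := dsubmx (dsubmx (ee g)) 0 0.
have eE g : ee g = cx (e1 g) (l g) (e2 g) by rewrite /cx -!mx11_scalar !vsubmxK.
pose l' g := l g - (e1 g / y1) *: v.
pose e2' g := e2 g - b (l g) v / y1 + e1 g * (b v v) / (2 * y1 ^+ 2).
have key g : isoR g ->
    (e1 g ^+ 2 * Y / y1 ^+ 2 + e2' g ^+ 2 * y1 ^+ 2 / Y + b (l' g) (l' g)) / 2 + gm g ^+ 2 * Y =
    ij g ^+ 2 / (2 * Y) + gm g * rj g.
  move=> ig; have := @shear y1 y2 (e1 g) (e2 g) v (l g) (lt0r_neq0 y1p).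
  rewrite /= -YE -/(l' g) -/(e2' g) => /(_ (lt0r_neq0 Y0)) <-.
  rewrite -eE -yE -ijE; rewrite (gE g) in ig; have := isotropic_identity ig.
  by rewrite -/(ee g) -YD -rjE => ->; ring.
have bound g : isoR g -> (e1 g ^+ 2 * Y / y1 ^+ 2 + e2' g ^+ 2 * y1 ^+ 2 / Y + b (l' g) (l' g)) / 2
     + gm g ^+ 2 * Y / 2 <= N g ^+ 2 / (2 * Y).
  (* The mixed term is absorbed by g Re j <= g^2 Y / 2 + (Re j)^2 / (2 Y), which leaves half of g^2
     Y on the left and completes |j|^2 on the right. *)
  move=> /key k; have : 0 <= (gm g * Y - rj g) ^+ 2 / (2 * Y).
    by rewrite divr_ge0 ?sqr_ge0// mulr_ge0// ltW.
  rewrite (_ : _ / _ = gm g ^+ 2 * Y / 2 - gm g * rj g + rj g ^+ 2 / (2 * Y)); last first.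
    by field; rewrite gt_eqF.
  by rewrite Nsq (mulrDl (rj g ^+ 2)); lra.
have t1 g : 0 <= e1 g ^+ 2 * Y / y1 ^+ 2.
  by rewrite divr_ge0 ?sqr_ge0// mulr_ge0 ?sqr_ge0// ltW.
have t2 g : 0 <= e2' g ^+ 2 * y1 ^+ 2 / Y.
  exact: divr_ge0 (mulr_ge0 (sqr_ge0 _) (sqr_ge0 _)) (ltW Y0).
have t3 g : 0 <= b (l' g) (l' g) by exact: S_ge0.
have t4 g : 0 <= gm g ^+ 2 * Y by rewrite mulr_ge0 ?sqr_ge0// ltW.
have aux (A B : R) : A * Y / 2 <= B / (2 * Y) -> A * Y ^+ 2 <= B.
  rewrite ler_pdivlMr ?mulr_gt0// => h; apply: le_trans h.
  by rewrite (_ : A * Y ^+ 2 = A * Y / 2 * (2 * Y)) ?lexx//; field.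
(* All terms on the left of [bound] are nonnegative, so each of them alone is at most |j|^2 / (2
   Y). *)
have Dgm : dom gm.
  apply: (@dominated_sqr _ _ _ _ N0 _ (Y ^+ 2)^-1) => g /bound h.
  have {}h : gm g ^+ 2 * Y / 2 <= N g ^+ 2 / (2 * Y) by have := t1 g; have := t2 g; have := t3 g; lra.
  rewrite mulrC ler_pdivlMr ?exprn_gt0//.
  exact: aux h.
have De1 : dom e1.
  apply: (@dominated_sqr _ _ _ _ N0 _ (y1 ^+ 2 / Y ^+ 2)) => g /bound h.
  have {}h : e1 g ^+ 2 * Y / y1 ^+ 2 / 2 <= N g ^+ 2 / (2 * Y) by have := t4 g; have := t2 g; have := t3 g; lra.
  rewrite -[leLHS](_ : e1 g ^+ 2 * Y / y1 ^+ 2 / 2 * (2 * y1 ^+ 2 / Y) = _); last first.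
    by field; rewrite !gt_eqF.
  rewrite [leRHS](_ : _ = N g ^+ 2 / (2 * Y) * (2 * y1 ^+ 2 / Y)); last by field; rewrite gt_eqF.
  by rewrite ler_wpM2r//; apply: divr_ge0; rewrite ?mulr_ge0 ?sqr_ge0// ltW.
have De2' : dom e2'.
  apply: (@dominated_sqr _ _ _ _ N0 _ (y1 ^+ 2)^-1) => g /bound h.
  have {}h : e2' g ^+ 2 * y1 ^+ 2 / Y / 2 <= N g ^+ 2 / (2 * Y) by have := t4 g; have := t1 g; have := t3 g; lra.
  rewrite -[leLHS](_ : e2' g ^+ 2 * y1 ^+ 2 / Y / 2 * (2 * Y / y1 ^+ 2) = _); last first.
    by field; rewrite !gt_eqF.
  rewrite [leRHS](_ : _ = N g ^+ 2 / (2 * Y) * (2 * Y / y1 ^+ 2)); last by field; rewrite !gt_eqF.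
  by rewrite ler_wpM2r// divr_ge0 ?sqr_ge0// mulr_ge0// ltW.
have Dl' i : dom (fun g => l' g i 0).
  have [c hc] := coord_le hS i.
  apply: (@dominated_sqr _ _ _ _ N0 _ (`|c| / Y)) => g /bound h.
  have {}h : b (l' g) (l' g) / 2 <= N g ^+ 2 / (2 * Y) by have := t4 g; have := t1 g; have := t2 g; lra.
  apply: le_trans (hc (l' g)) _; rewrite -/b.
  apply: (@le_trans _ _ (`|c| * b (l' g) (l' g))); first by rewrite ler_wpM2r// ler_norm.
  rewrite -mulrA ler_wpM2l// -[leLHS](_ : b (l' g) (l' g) / 2 * 2 = _); last by field.
  rewrite [leRHS](_ : _ = N g ^+ 2 / (2 * Y) * 2); last by field; rewrite gt_eqF.
  by rewrite ler_wpM2r.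
(* From here the shear is undone, giving l and e2, and then d = e + g x. *)
have Dl i : dom (fun g => l g i 0).
  apply: dominated_ext (dominatedD (Dl' i) (dominatedZ (v i 0 / y1) De1)) => g _.
  by rewrite /l' !mxE; field; rewrite gt_eqF.
have Dlv : dom (fun g => b (l g) v).
  apply: dominated_ext (dominated_sum (index_enum 'I_n) (fun i => dominatedZ ((inF R S *m v) i 0) (Dl i))) => g _.
  by rewrite /b /bf -mulmxA [RHS]mxE; apply: eq_bigr => i _; rewrite [(l g)^T 0 i]mxE mulrC.
have De2 : dom e2.
  apply: dominated_ext (dominatedB (dominatedD De2' (dominatedZ (y1^-1) Dlv))
     (dominatedZ (b v v / (2 * y1 ^+ 2)) De1)) => g _.
  by rewrite /e2'; field; rewrite gt_eqF.
have De i : dom (fun g => ee g i 0).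
  apply: (@dominated_ext _ _ _ _ (fun g => cx (e1 g) (l g) (e2 g) i 0)); first by move=> g _; rewrite -eE.
  rewrite /cx; case: (split_ordP i) => j ->.
    by apply: dominated_ext De1 => g _; rewrite col_mxEu mxE ord1 mulr1n.
  case: (split_ordP j) => {}j ->.
    by apply: dominated_ext (Dl j) => g _; rewrite col_mxEd col_mxEu.
  by apply: dominated_ext De2 => g _; rewrite !col_mxEd mxE ord1 mulr1n.
have Dd i : dom (fun g => dd g i 0).
  apply: dominated_ext (dominatedD (De i) (dominatedZ (x i 0) Dgm)) => g _.
  by rewrite /ee [in LHS]mxE [X in _ + X + _]mxE [X in _ + - X + _]mxE; ring.
split=> //.
(* The first entry is not part of e; it is recovered from the formula for Re j. *)
have Drj : dom rj by exists 1 => // g _; rewrite mul1r; exact: normRe_le.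
have Ddx : dom (fun g => b0 (dd g) x).
  apply: dominated_ext (dominated_sum (index_enum 'I_(dim0 n)) (fun i => dominatedZ ((inF R (S0 S) *m x) i 0) (Dd i))) => g _.
  by rewrite /b0 /bf -mulmxA [RHS]mxE; apply: eq_bigr => i _; rewrite [(dd g)^T 0 i]mxE mulrC.
apply: dominated_ext (dominatedB (dominatedD Drj (dominatedZ (b0 x x / 2 - Y) Dgm)) Ddx) => g _.
by rewrite rjE -/(dl g); ring.
Qed.

End LowerBound.

(** * Termwise differentiation *)

Section Holomorphic.
Context (R : realType) (m : nat).
Notation C := R[i].

Definition lin_form (a : 'I_m -> C) (h : 'cV[Cx R]_m) : Cx R := \sum_i (a i : Cx R) * h i 0.

Fact lin_form_is_linear a : linear (lin_form a).
Proof.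
move=> k u v; rewrite /lin_form scaler_sumr -big_split; apply: eq_bigr => i _ /=.
by rewrite !mxE mulrDr /GRing.scale/= mulrCA.
Qed.

HB.instance Definition _ a :=
  GRing.isLinear.Build (Cx R) 'cV[Cx R]_m (Cx R) _ (lin_form a) (lin_form_is_linear a).

Lemma lin_form_continuous a : continuous (lin_form a).
Proof.
rewrite /lin_form; apply: (@continuous_sum (Cx R) (Cx R)) => i x.
have h : (y : 'cV[Cx R]_m) i 0 @[y --> x] --> x i 0 by exact: (@coord_continuous (Cx R) m 1 i 0 x).
exact: (cvgM (cvg_cst (a i : Cx R)) h).
Qed.

Lemma coord_le_norm (h : 'cV[Cx R]_m) i : nrm (h i 0 : C) <= complex.Re (`|h| : C).
Proof.
have hr : (complex.Re (`|h| : C))%:C%C = `|h| by rewrite RRe_real// ger0_real.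
rewrite -lecR hr -normr_nrm [leRHS]/Num.Def.normr /= mx_normE.
apply: (@le_trans _ _ ((`|h i 0|%:nng)%:num)); first by [].
rewrite num_le.
exact: (le_bigmax _ (fun x : 'I_m * 'I_1 => (`|h x.1 x.2|%:nng)%R) (i, 0)).
Qed.

(** A remainder of second order is little-o of h. The bound is phrased with a real H dominating the
    coordinates, so that users work with real moduli and not with the norm valued in [Cx R]. *)
Lemma differentiable_quadratic (f : 'cV[C]_m -> C) (z : 'cV[C]_m) (a : 'I_m -> C) (B r0 : R) :
  0 < r0 ->
  (forall (h : 'cV[C]_m) (H : R), (forall i, nrm (h i 0) <= H) -> 0 <= H -> H <= r0 ->
    nrm (f (h + z) - f z - \sum_i a i * h i 0) <= B * H ^+ 2) ->
  differentiable (f : 'cV[Cx R]_m -> Cx R) (z : 'cV[Cx R]_m).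
Proof.
move=> r00 hf.
have E : (f : 'cV[Cx R]_m -> Cx R) \o shift (z : 'cV[Cx R]_m) = cst (f z : Cx R) + lin_form a +o_ (0 : 'cV[Cx R]_m) id.
  apply/eqaddoP => e e0.
  have eE : e = ((complex.Re e)%:C)%C by rewrite RRe_real// ger0_real// ltW.
  have re0 : 0 < complex.Re e by move: e0; rewrite {1}eE ltcR.
  (* Within radius r the remainder B H^2 is at most e H. *)
  pose r := Num.min r0 (complex.Re e / (`|B| + 1)).
  have B1 : 0 < `|B| + 1 by rewrite ltr_wpDl.
  have r1 : 0 < r by rewrite lt_min r00 divr_gt0.
  have rc0 : (0 : Cx R) < (r%:C)%C by rewrite ltcR.
  have nh : \forall h \near (0 : 'cV[Cx R]_m), `|h| < ((r%:C)%C : Cx R) by exact: nbhs0_lt.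
  near=> h.
  have hr : `|h| < ((r%:C)%C : Cx R) by near: h.
  have hE : `|h| = ((complex.Re (`|h| : C))%:C)%C by rewrite RRe_real// ger0_real.
  set H := complex.Re (`|h| : C) in hE.
  have H0 : 0 <= H by rewrite -ler0c -hE.
  have {hr} Hr : H < r by move: hr; rewrite hE ltcR.
  have Hr0 : H <= r0 by apply: le_trans (ltW Hr) _; rewrite ge_min lexx.
  have := hf h H (coord_le_norm h) H0 Hr0.
  have BH : B * H ^+ 2 <= complex.Re e * H.
    rewrite expr2 mulrA ler_wpM2r//.
    have Hr2 : H < complex.Re e / (`|B| + 1) by apply: lt_le_trans Hr _; rewrite ge_min lexx orbT.
    move: Hr2; rewrite ltr_pdivlMr// => Hr2; apply: le_trans (ltW Hr2).
    by rewrite mulrC ler_wpM2l//; apply: le_trans (ler_norm B) _; rewrite lerDl.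
  move=> fh; have {fh BH} := le_trans fh BH.
  rewrite -lecR rmorphM /= -hE -normr_nrm -eE => fh; apply: le_trans fh.
  by rewrite /= opprD addrA.
have dE := diff_unique (@lin_form_continuous a) E.
apply/diff_locallyP; rewrite dE; split=> //; exact: lin_form_continuous.
Unshelve. all: by end_near.
Qed.

End Holomorphic.

(** * Second-order expansion of inverse powers *)

Section Remainder.
Context (R : realType).
Notation C := R[i].

Lemma nrm_nat k : nrm (k%:R : C) = k%:R.
Proof. by rewrite -(rmorph_nat (real_complex R)) nrmR ger0_norm. Qed.

Lemma nrm1D_ge (u : C) : nrm u <= 2^-1 -> 2^-1 <= nrm (1 + u).
Proof.
move=> hu; have := nrmD (1 + u) (- u); rewrite addrK nrmN Normc.normc1; lra.
Qed.

Lemma nrm1D_inv (u : C) : nrm u <= 2^-1 -> nrm (1 + u)^-1 <= 2.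
Proof.
move=> /nrm1D_ge h; rewrite nrmV -[leRHS]invrK lef_pV2 ?posrE ?invr_gt0//.
by apply: lt_le_trans h; rewrite invr_gt0.
Qed.

(** Induction: multiplying the remainder for k + 1 by 1 + u gives the remainder for k plus (k + 1)
    u^2, and |1 + u|^-1 <= 2 accounts for the factor 2. *)
Lemma inv_pow_remainder k : exists2 K : R, 0 <= K & forall u : C, nrm u <= 2^-1 ->
  nrm ((1 + u) ^- k - 1 + k%:R * u) <= K * nrm u ^+ 2.
Proof.
elim: k => [|k [K K0 IH]].
  by exists 0 => // u _; rewrite expr0 invr1 subrr mul0r addr0 nrm0 mul0r.
exists (2 * (K + k.+1%:R)) => [|u hu]; first by rewrite mulr_ge0// addr_ge0.
have u0 : 1 + u != 0 by rewrite -nrm_eq0 gt_eqF//; apply: lt_le_trans (nrm1D_ge hu); rewrite invr_gt0.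
have -> : (1 + u) ^- k.+1 - 1 + k.+1%:R * u =
    (1 + u)^-1 * (((1 + u) ^- k - 1 + k%:R * u) + k.+1%:R * u ^+ 2).
  rewrite exprS invfM -[k.+1]addn1 natrD; move: ((1 + u) ^- k) => w; field.
  exact: u0.
rewrite nrmM -mulrA; apply: ler_pM; rewrite ?nrm_ge0 ?nrm1D_inv//.
apply: le_trans (nrmD _ _) _; rewrite mulrDl lerD ?IH//.
by rewrite nrmM nrmX nrm_nat.
Qed.

End Remainder.

(** * The Eisenstein series *)

Section Eisenstein.
Context (R : realType) (n : nat) (S : 'M[int]_n).
Hypothesis hS : even_posdef R S.
Notation C := R[i].
Notation rc := (real_complex R).

Definition size1 m (g : 'cV[R]_m) : R := \sum_i `|g i 0|.

Lemma size1_ge0 m (g : 'cV[R]_m) : 0 <= size1 g.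
Proof. by apply: sumr_ge0 => i _. Qed.

Lemma size1_eq0 m (g : 'cV[R]_m) : size1 g = 0 -> g = 0.
Proof.
move=> /eqP; rewrite psumr_eq0 => [/allP h|i _//].
apply/matrixP => i j; rewrite ord1 mxE; apply/eqP.
by rewrite -normr_eq0; apply: h; rewrite mem_index_enum.
Qed.

Lemma size1_le m (g : 'cV[R]_m) i : `|g i 0| <= size1 g.
Proof. by rewrite /size1 (bigD1 i)//= lerDl sumr_ge0. Qed.

Lemma size1_cx m a (v : 'cV[R]_m) b : size1 (cx a v b) = `|a| + size1 v + `|b|.
Proof.
rewrite /size1 (@big_split_ord _ _ _ 1 (m + 1)) /= big_ord1 (@big_split_ord _ _ _ m 1) /= big_ord1.
rewrite /cx col_mxEu !col_mxEd !mxE !mulr1n addrA; congr (_ + _ + _).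
by apply: eq_bigr => i _; rewrite col_mxEd col_mxEu.
Qed.

Lemma size1_scale m k (g : 'cV[R]_m) : size1 (k *: g) = `|k| * size1 g.
Proof. by rewrite /size1 mulr_sumr; apply: eq_bigr => i _; rewrite mxE normrM. Qed.

Definition tup5 (x : vec5 n) : 'cV[int]_(dim1 n) :=
  let: (a, b, c, d, v) := x in mk5 a b v c d.

Lemma norm5_tup x : norm5 R x = size1 (inF R (tup5 x)).
Proof.
case: x => [[[[a b] c] d] v]; rewrite /tup5 inF_mk5 !size1_cx /norm5 -!intr_norm -!abszE.
rewrite (_ : size1 (inF R v) = norm1 R v); first by ring.
by apply: eq_bigr => i _; rewrite mxE -intr_norm -abszE.
Qed.

Lemma size1_jreal (z : 'cV[C]_(dim0 n)) : half_space S z ->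
  exists2 K, 0 <= K & forall g, isoR S g -> size1 g <= K * nrm (jreal S z g).
Proof.
move=> hz; have [h1 h2 h3] := jreal_dominated hS hz.
have abs f : dominated (isoR S) (fun g => nrm (jreal S z g)) f ->
    dominated (isoR S) (fun g => nrm (jreal S z g)) (fun g => `|f g|).
  by case=> K K0 hK; exists K => // g /hK; rewrite normr_id.
have [K K0 hK] : dominated (isoR S) (fun g => nrm (jreal S z g)) (fun g => size1 g).
  apply: dominated_ext (dominatedD (dominatedD (abs _ h1) (dominated_sum (index_enum _) (fun i => abs _ (h3 i)))) (abs _ h2)) => g _.
  by rewrite -size1_cx /cx -!mx11_scalar !vsubmxK.
by exists K => // g /hK; rewrite ger0_norm ?size1_ge0.
Qed.

Lemma jvec_jreal g (z : 'cV[C]_(dim0 n)) : jvec S g z = jreal S z (map_mx ratr g).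
Proof.
rewrite jvecE /jreal.
have -> : map_mx ratr g = map_mx rc (map_mx ratr g) :> 'cV[C]_(dim1 n); last by [].
rewrite -map_mx_comp; apply/eq_map_mx => q.
by rewrite /= -[RHS]/(rc (ratr _)) fmorph_rat.
Qed.

Lemma isoR_ratr (g : 'cV[rat]_(dim1 n)) :
  bf (inF rat (S1 S)) g g = 0 -> isoR S (map_mx ratr g : 'cV[R]_(dim1 n)).
Proof.
by move=> /(congr1 (@ratr R)); rewrite map_bf rmorph0 map_ratr_inF.
Qed.

Lemma jvec_neq0 g (z : 'cV[C]_(dim0 n)) : half_space S z ->
  bf (inF rat (S1 S)) g g = 0 -> g != 0 -> jvec S g z != 0.
Proof.
move=> hz ig; apply: contra => /eqP j0.
have [K K0 hK] := size1_jreal hz; have := hK _ (isoR_ratr ig).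
rewrite -jvec_jreal j0 nrm0 mulr0 => h.
have /size1_eq0/eqP : size1 (map_mx ratr g : 'cV[R]_(dim1 n)) = 0.
  by apply/eqP; rewrite eq_le h size1_ge0.
by rewrite map_mx_eq0.
Qed.

(** As the last entry of M w(z), j(M, z) equals j(M^-1 e_1, z), and M^-1 e_1 is isotropic and
    nonzero. *)
Lemma jM_neq0 M (z : 'cV[C]_(dim0 n)) : half_space S z ->
  disc_kernel R S M -> jM S (inF C M) z != 0.
Proof.
move=> hz gM; have uM := disc_kernel_unit hS gM; have oM := disc_kernel_ortho gM.
pose e1 : 'cV[rat]_(dim1 n) := cx 1 0 0.
have oV : (inF rat (invmx M))^T *m inF rat (S1 S) *m inF rat (invmx M) = inF rat (S1 S).
  by apply: inF_ortho; apply: (disc_kernel_ortho (R := R)); exact: disc_kernelV.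
have MM : inF rat M *m inF rat (invmx M) = 1%:M by rewrite -inF_mul mulmxV// inF1.
have -> : jM S (inF C M) z = jvec S (inF rat (invmx M) *m e1) z.
  rewrite jM_last (last_entry_bf S) jvecE -[in RHS](inF_ortho C oM) -bf_mul.
  have -> : inF C M *m map_mx ratr (inF rat (invmx M) *m e1) = map_mx ratr e1.
    by rewrite -map_ratr_inF -map_mxM mulmxA MM mul1mx.
  by rewrite map_cx rmorph1 !rmorph0 map_mx0.
apply: jvec_neq0 => //.
  by rewrite bf_mul oV inF_S1 bf_hyp_ext bf0l mul0r mulr0 !addr0.
apply/eqP => e0; have /eqP : inF rat M *m (inF rat (invmx M) *m e1) = 0 by rewrite e0 mulmx0.
rewrite mulmxA MM mul1mx /e1 -(cx0 _ (dim0 n)) => /eqP/cx_inj[] /eqP.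
by rewrite oner_eq0.
Qed.

Context (c0 : 'cV[rat]_n) (s0 : 'cV[int]_n) (Qc0 : int).
Hypotheses (Sc0 : inF rat S *m c0 = inF rat s0)
  (Qc0E : qform (inF rat S) c0 = Qc0%:~R).
Notation prim := (prim_isotropic S c0).

Lemma prim_iso g : prim g -> bf (inF rat (S1 S)) g g = 0.
Proof.
by case=> _ _; rewrite /qform => /eqP; rewrite mulf_eq0 invr_eq0 pnatr_eq0 => /eqP.
Qed.

Lemma prim_cvec g : prim g -> exists d p l q h, g = cvec c0 d p l q h.
Proof.
case=> [[L gE] _ _]; have [d [p [l [q [h LE]]]]] := mk5_surj L.
exists (d + 1), p, l, q, (h + Qc0).
rewrite gE LE (cusp_vecE Qc0E) inF_mk5 /cvec mk5D [inF rat 0]map_mx0 !rmorphD /= !addr0.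
by rewrite add0r.
Qed.

Lemma prim_neq0 g : prim g -> g != 0.
Proof.
move=> pr; apply/eqP => g0; have [d [p [l [q [h gE]]]]] := prim_cvec pr.
have g00 : mk5 (0 : rat) 0 (0 : 'cV_n) 0 0 = 0 by rewrite /mk5 !cx0.
move: g0; rewrite gE -g00 => /cx_inj[/eqP d0 /cx_inj[/eqP p0 _ /eqP q0] /eqP h0].
rewrite !intr_eq0 in d0 p0 q0 h0; move: pr.
by rewrite gE (eqP d0) (eqP p0) (eqP q0) (eqP h0) => /(prim_nonzero hS Sc0).
Qed.

(** With D = det S, the vector D c0 = adj(S) S c0 is integral, so D g is an integral isotropic
    vector to which the lattice sum applies. *)
Lemma prim_tuple : exists D : int, D != 0 /\ exists x5 : 'cV[rat]_(dim1 n) -> vec5 n,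
  forall g, prim g -> iso5 (fun v => bf S v v) (x5 g) /\ D%:~R *: g = inF rat (tup5 (x5 g)).
Proof.
pose D := \det S.
have D0 : D != 0.
  have := S_unit hS rat; rewrite unitmxE unitfE -[inF rat S]/(map_mx intr S) det_map_mx.
  by rewrite intr_eq0.
have Dc0 : D%:~R *: c0 = inF rat (\adj S *m s0).
  rewrite inF_mul -Sc0 mulmxA -inF_mul mul_adj_mx /inF map_scalar_mx.
  by rewrite mul_scalar_mx.
exists D; split => //.
suff ex g : exists x : vec5 n, prim g ->
    iso5 (fun v => bf S v v) x /\ D%:~R *: g = inF rat (tup5 x).
  by have [x5 hx5] := choice ex; exists x5.
case: (pselect (prim g)) => [pr|npr]; last by exists (0, 0, 0, 0, 0).
have [d [p [l [q [h gE]]]]] := prim_cvec pr.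
have DgE : D%:~R *: g = inF rat (mk5 (D * d) (D * p) (D *: l + \adj S *m s0) (D * q) (D * h)).
  rewrite gE inF_mk5 /cvec mk5Z !rmorphM /= scalerDr Dc0 inFD.
  by rewrite [inF rat (D *: l)]map_mxZ.
exists (D * d, D * p, D * q, D * h, D *: l + \adj S *m s0) => _; split => //.
split.
- have : bf (inF rat (S1 S)) (D%:~R *: g) (D%:~R *: g) = 0.
    by rewrite bfZl bfZr prim_iso// !mulr0.
  rewrite DgE inF_mk5 bf_S1 /inF -map_bf -/(inF _ _) => /eqP; rewrite subr_eq0 => /eqP e.
  apply: (@intr_inj rat); rewrite -[RHS]e !(rmorphM, rmorphD) /=; ring.
- rewrite !mulf_eq0 (negbTE D0) /=; apply: contraT; rewrite !negb_or !negbK.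
  move=> /and4P[/eqP d0 /eqP p0 /eqP q0 /eqP h0]; move: pr.
  by rewrite gE d0 p0 q0 h0 => /(prim_nonzero hS Sc0).
Qed.

Lemma prim_summable k (z : 'cV[C]_(dim0 n)) : (n + 2 < k)%N -> half_space S z ->
  abs_summable prim (fun g => jvec S g z ^- k).
Proof.
move=> hk hz; apply/abs_summableP.
have [K K0 hK] := size1_jreal hz.
have [D [D0 [x5 hx]]] := prim_tuple.
have inj : set_inj prim x5.
  move=> g g' /set_mem pg /set_mem pg' e.
  have DD : (D%:~R : rat) != 0 by rewrite intr_eq0.
  by apply: (scalerI DD); rewrite (hx _ pg).2 (hx _ pg').2 e.
have q0 v : bf S v v = 0 -> v = 0.
  move=> e; apply: (@inF_inj R); rewrite [RHS]map_mx0; apply/eqP; apply: contraT => /(S_pos hS).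
  by rewrite -[inF R S]/(map_mx intr S) -[inF R v]/(map_mx intr v) -map_bf e ltxx.
have [C0 HC] := @sum_le_iso5 R n (fun v => bf S v v) q0.
pose A := `|D%:~R : R| * K.
have bound g : prim g -> norm5 R (x5 g) <= A * nrm (jvec S g z).
  move=> pg; have /(congr1 (map_mx (@ratr R))) := (hx _ pg).2.
  rewrite map_mxZ map_ratr_inF rmorph_int norm5_tup => <-.
  rewrite size1_scale /A -mulrA ler_wpM2l// jvec_jreal; apply: hK.
  by apply: isoR_ratr; exact: prim_iso.
have n1 g : prim g -> 1 <= norm5 R (x5 g).
  move=> pg; case: (hx _ pg) => + _; case: (x5 g) => [[[[a b] c] d] v] [_ nz].
  rewrite /norm5 -!natrD; apply: (@le_trans _ _ ((absz a + absz b + absz c + absz d)%:R)).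
    by rewrite ler1n; lia.
  by rewrite lerDl norm1_ge0.
exists (A ^+ k * C0).
apply: sum_le_mono (sum_leZ _ (sum_le_inj inj (fun g pg => (hx g pg).1) HC)); last first.
  by rewrite exprn_ge0// mulr_ge0.
move=> g pg /=; rewrite nrmV nrmX.
have A0 : 0 < A.
  rewrite lt_neqAle mulr_ge0// andbT; apply/eqP => A0.
  by have := le_trans (n1 _ pg) (bound _ pg); rewrite -A0 mul0r ler10.
apply: le_trans (invX_scale k A0 (lt_le_trans ltr01 (n1 _ pg)) (bound _ pg)) _.
(* The norm is at least 1 and k >= n + 3, so the exponent may be lowered to n + 3. *)
rewrite ler_wpM2l ?exprn_ge0 ?(ltW A0)//.
rewrite lef_pV2 ?posrE ?exprn_gt0// ?(lt_le_trans ltr01 (n1 _ pg))//.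
by rewrite ler_weXn2l ?n1//; lia.
Qed.

(** The assumption is summability at z, so the lemma also serves at M<z> and at z + h, where
    summability is transported from z. *)
Lemma eisenstein_csum k (z : 'cV[C]_(dim0 n)) :
  abs_summable prim (fun g => jvec S g z ^- k) ->
  abs_summable (cosets R S c0) (eis_term S c0 k z) /\
  eisenstein R S c0 k z = 2^-1 * csum prim (fun g => jvec S g z ^- k).
Proof.
move=> sm; have bij := orbit_vec_bij hS Sc0 Qc0E.
have termE A : cosets R S c0 A -> jvec S (orbit_vec S c0 A) z ^- k = eis_term S c0 k z A.
  by move=> hA; rewrite (eis_term_orbit hS Qc0E).
split.
  move/abs_summableP: (sm) => [K hK]; apply/abs_summableP; exists K.
  case: bij => im inj _; apply: sum_le_mono (sum_le_inj inj im hK) => A hA /=.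
  by rewrite termE.
have [T hT] := has_sum_exists sm.
rewrite /eisenstein (has_sum_csum hT); congr (_ * _); apply: has_sum_csum.
by apply: has_sum_ext (has_sum_bij bij hT) => A /termE.
Qed.

Lemma eisenstein_modular k (z : 'cV[C]_(dim0 n)) M : (n + 2 < k)%N -> half_space S z ->
  disc_kernel R S M ->
  jM S (inF C M) z ^- k * eisenstein R S c0 k (act S (inF C M) z) = eisenstein R S c0 k z.
Proof.
move=> hk hz gM; have j0 := jM_neq0 hz gM; have uM := disc_kernel_unit hS gM.
set J := jM S (inF C M) z in j0 *.
have sm := prim_summable hk hz; have [T hT] := has_sum_exists sm.
have gV := disc_kernelV hS gM.
have bij : set_bij prim prim (fun g => inF rat (invmx M) *m g).
  split.
  - by move=> g pg; apply: (prim_mul hS Sc0 Qc0E).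
  - move=> g g' _ _ e; have : inF rat M *m (inF rat (invmx M) *m g) =
      inF rat M *m (inF rat (invmx M) *m g') by rewrite e.
    by rewrite !mulmxA -!inF_mul mulmxV// inF1 !mul1mx.
  - move=> g pg; exists (inF rat M *m g); first exact: (prim_mul hS Sc0 Qc0E).
    by rewrite mulmxA -inF_mul mulVmx// inF1 mul1mx.
have termE g : J ^+ k * jvec S (inF rat (invmx M) *m g) z ^- k = jvec S g (act S (inF C M) z) ^- k.
  rewrite -(jvec_act hS g gM j0) exprMn invfM mulrCA mulfV ?mulr1// expf_neq0//.
have hT' := has_sumZ (J ^+ k) (has_sum_bij bij hT).
(* Summability at M<z> is inherited from z by the reindexing. *)
have sm' : abs_summable prim (fun g => jvec S g (act S (inF C M) z) ^- k).
  move/abs_summableP: sm => [K hK]; apply/abs_summableP; exists (nrm (J ^+ k) * K).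
  case: bij => im inj _.
  apply: sum_le_mono (sum_leZ (nrm_ge0 _) (sum_le_inj inj im hK)) => g _ /=.
  by rewrite -termE nrmM.
rewrite (eisenstein_csum sm).2 (eisenstein_csum sm').2 (has_sum_csum hT).
rewrite (has_sum_csum (has_sum_ext (fun g _ => termE g) hT')).
by rewrite mulrCA mulKf// expf_neq0.
Qed.

(** An exact Taylor expansion, as j(g, .) is a quadratic polynomial: the linear part is (d - gamma
    z, h)_0. *)
Lemma jvec_shift g (z h : 'cV[C]_(dim0 n)) :
  jvec S g (h + z) = jvec S g z
    + bf (inF C (S0 S)) (map_mx ratr (usubmx (dsubmx g)) - ratr (dsubmx (dsubmx g) 0 0) *: z) h
    - ratr (dsubmx (dsubmx g) 0 0) * Q0 S h.
Proof.
have gE : g = cx (usubmx g 0 0) (usubmx (dsubmx g)) (dsubmx (dsubmx g) 0 0).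
  by rewrite /cx -!mx11_scalar !vsubmxK.
rewrite !jvecE {1 2}gE map_cx inF_S1 !bf_hyp_ext.
have QD : Q0 S (h + z) = Q0 S h + Q0 S z + bf (inF C (S0 S)) z h.
  apply: (@mulfI _ 2); first by rewrite pnatr_eq0.
  rewrite -Q0E !mulrDr -!Q0E !(bfDl, bfDr) (bfC h z (tr_inF_S0 _ (symS hS))).
  by move: (bf _ h h) (bf _ z h) (bf _ z z) => b1 b2 b3; ring.
rewrite QD !(bfDl, bfDr, bfNl, bfZl).
move: (Q0 S h) (Q0 S z) (bf _ z h) (bf _ _ h) (bf _ _ z) => b1 b2 b3 b4 b5; ring.
Qed.

(* [j(g, z + h) = j(g, z) (1 + u)] with [|u| <= A |h|] uniformly in [g], so the series can
   be differentiated termwise with a remainder of order [|h|^2]; no locally uniform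
   convergence is needed. *)
Lemma eisenstein_holomorphic k : (n + 2 < k)%N ->
  holomorphic_on (half_space S) (eisenstein R S c0 k).
Proof.
move=> hk z hz.
have sm := prim_summable hk hz.
have [K K0 hK] := size1_jreal hz.
move/abs_summableP: (sm) => [M hM].
pose J g := jvec S g z.
pose gm (g : 'cV[rat]_(dim1 n)) : C := ratr (dsubmx (dsubmx g) 0 0).
pose dv (g : 'cV[rat]_(dim1 n)) : 'cV[C]_(dim0 n) := map_mx ratr (usubmx (dsubmx g)) - gm g *: z.
pose a g i : C := \sum_l dv g l 0 * inF C (S0 S) l i.
have ratrE (q : rat) : nrm (ratr q : C) = `|ratr q : R|.
  by rewrite -(fmorph_rat (real_complex R)) nrmR.
have J0 g : prim g -> J g != 0.
  by move=> pg; apply: jvec_neq0 => //; [exact: prim_iso|exact: prim_neq0].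
have coord g i : prim g -> nrm (ratr (g i 0) : C) <= K * nrm (J g).
  move=> pg; rewrite ratrE /J jvec_jreal; apply: le_trans (hK _ (isoR_ratr (prim_iso pg))).
  by have := size1_le (map_mx ratr g : 'cV[R]_(dim1 n)) i; rewrite mxE.
have gmB g : prim g -> nrm (gm g) <= K * nrm (J g) by move=> pg; rewrite /gm !mxE; exact: coord.
pose q : R := \sum_i \sum_l nrm (inF C (S0 S) l i).
have q0 : 0 <= q by apply: sumr_ge0 => i _; apply: sumr_ge0 => l _; exact: nrm_ge0.
(* The factor 1 + |z_l| bounds the entries of d - gamma z, given that d and gamma are at most K
   |j(g, z)|. *)
pose K' : R := K * \sum_i \sum_l (1 + nrm (z l 0)) * nrm (inF C (S0 S) l i).
have K'0 : 0 <= K'.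
  rewrite mulr_ge0//; apply: sumr_ge0 => i _; apply: sumr_ge0 => l _.
  by rewrite mulr_ge0 ?nrm_ge0// addr_ge0// nrm_ge0.
have aB g : prim g -> \sum_i nrm (a g i) <= K' * nrm (J g).
  move=> pg; rewrite /K' mulrAC mulr_sumr; apply: ler_sum => i _.
  apply: le_trans (nrm_sum _ _ _) _; rewrite mulr_sumr; apply: ler_sum => l _.
  rewrite nrmM mulrA ler_wpM2r ?nrm_ge0//.
  have -> : dv g l 0 = ratr (usubmx (dsubmx g) l 0) - gm g * z l 0 by rewrite /dv !mxE.
  apply: le_trans (nrmD _ _) _; rewrite nrmN nrmM mulrDr mulr1.
  by rewrite lerD ?ler_wpM2r ?nrm_ge0 ?gmB// !mxE coord.
have lE g h : bf (inF C (S0 S)) (dv g) h = \sum_i a g i * h i 0.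
  rewrite /bf mxE; apply: eq_bigr => i _; congr (_ * _); rewrite mxE.
  by apply: eq_bigr => l _; rewrite [(dv g)^T _ _]mxE.
have lB g (h : 'cV[C]_(dim0 n)) (H : R) : prim g -> (forall i, nrm (h i 0) <= H) ->
    nrm (\sum_i a g i * h i 0) <= K' * nrm (J g) * H.
  move=> pg hH; apply: le_trans (nrm_sum _ _ _) _.
  apply: (@le_trans _ _ ((\sum_i nrm (a g i)) * H)).
    by rewrite mulr_suml; apply: ler_sum => i _; rewrite nrmM ler_wpM2l ?nrm_ge0.
  have [i0|noi] := pselect (exists i : 'I_(dim0 n), True); last first.
    by exfalso; apply: noi; exists ord0.
  case: i0 => i0 _.
  by rewrite ler_wpM2r ?aB// (le_trans (nrm_ge0 _) (hH i0)).
have qB (h : 'cV[C]_(dim0 n)) (H : R) : (forall i, nrm (h i 0) <= H) -> nrm (Q0 S h) <= q * H ^+ 2.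
  move=> hH; rewrite /Q0 /qform nrmM.
  have n2 : nrm (2^-1 : C) <= 1.
    by rewrite nrmV nrm_nat invf_le1// ler1n.
  apply: (@le_trans _ _ (1 * nrm (bil (inF C (S0 S)) h h))); first by rewrite ler_wpM2r ?nrm_ge0.
  rewrite mul1r [X in nrm X]mxE; apply: le_trans (nrm_sum _ _ _) _; rewrite /q mulr_suml.
  apply: ler_sum => i _; rewrite nrmM mxE.
  have H0 : 0 <= H by apply: le_trans (nrm_ge0 _) (hH i).
  apply: (@le_trans _ _ ((\sum_l H * nrm (inF C (S0 S) l i)) * H)); last first.
    by rewrite mulr_suml [leRHS]mulr_suml; apply: ler_sum => l _; rewrite expr2 mulrA [H * _]mulrC.
  rewrite ler_pM ?nrm_ge0//; apply: le_trans (nrm_sum _ _ _) _; apply: ler_sum => l _.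
  by rewrite nrmM mxE ler_wpM2r ?nrm_ge0.
pose A := K' + K * q.
have A0 : 0 <= A by rewrite addr_ge0// mulr_ge0.
have [Ck Ck0 hCk] := inv_pow_remainder R k.
(* The first summand bounds the remainder of (1 + u)^-k, the second the quadratic part of u. *)
pose B := Ck * A ^+ 2 + k%:R * (K * q).
(* Ensures both H <= 1, so that H^2 <= H, and A H <= 1/2. *)
pose r0 : R := (2 * (A + 1))^-1.
have A1 : 0 < A + 1 by rewrite ltr_wpDl.
have r00 : 0 < r0 by rewrite invr_gt0 mulr_gt0.
pose u g (h : 'cV[C]_(dim0 n)) := (\sum_i a g i * h i 0 - gm g * Q0 S h) / J g.
have uE g h : prim g -> jvec S g (h + z) = J g * (1 + u g h).
  move=> pg; have e : J g * u g h = \sum_i a g i * h i 0 - gm g * Q0 S h.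
    by rewrite mulrC divfK ?J0.
  by rewrite jvec_shift -/(gm g) -/(dv g) lE mulrDr mulr1 e addrA.
have uB g (h : 'cV[C]_(dim0 n)) (H : R) : prim g -> (forall i, nrm (h i 0) <= H) -> 0 <= H -> H <= r0 ->
    nrm (u g h) <= A * H /\ nrm (u g h) <= 2^-1.
  move=> pg hH H0 Hr; have Jp : 0 < nrm (J g) by rewrite lt_neqAle eq_sym nrm_eq0 J0// nrm_ge0.
  have H1 : H <= 1.
    by apply: le_trans Hr _; rewrite /r0 invf_le1 ?mulr_gt0//; lra.
  have uA : nrm (u g h) <= A * H.
    rewrite /u nrmM nrmV ler_pdivrMr//; apply: le_trans (nrmD _ _) _.
    rewrite nrmN nrmM /A mulrDl mulrDl lerD//; first by rewrite mulrAC lB.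
    apply: (@le_trans _ _ (K * nrm (J g) * (q * H))).
      apply: ler_pM; rewrite ?nrm_ge0 ?gmB//; apply: le_trans (qB _ _ hH) _.
      by rewrite ler_wpM2l// expr2 ler_piMl.
    by rewrite le_eqVlt; apply/orP; left; apply/eqP; ring.
  split=> //; apply: le_trans uA _; apply: (@le_trans _ _ ((A + 1) * r0)).
    by apply: ler_pM => //; rewrite lerDl.
  by rewrite /r0 invfM mulrCA divff ?mulr1// gt_eqF.
have [T hT] := has_sum_exists sm.
(* The differentiated series: [a g i] is at most K' |J|, which compensates the extra power of J. *)
have sD i : abs_summable prim (fun g => a g i / J g ^+ k.+1).
  apply/abs_summableP; exists (K' * M); apply: sum_le_mono (sum_leZ K'0 hM) => g pg.
  have Jp : 0 < nrm (J g) by rewrite lt_neqAle eq_sym nrm_eq0 J0// nrm_ge0.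
  rewrite !(nrmM, nrmV, nrmX) exprS invfM mulrA ler_wpM2r ?invr_ge0 ?exprn_ge0 ?nrm_ge0//.
  rewrite ler_pdivrMr//; apply: le_trans (aB _ pg).
  by rewrite (bigD1 i)//= lerDl sumr_ge0// => l _; exact: nrm_ge0.
have [D hD] := choice (fun i => has_sum_exists (sD i)).
apply: (@differentiable_quadratic _ _ _ _ (fun i => 2^-1 * (- k%:R * D i)) (B * M) r0 r00) => h H hH H0 Hr.
have sm' : abs_summable prim (fun g => jvec S g (h + z) ^- k).
  apply/abs_summableP; exists (2 ^+ k * M).
  have := sum_leZ (exprn_ge0 k (ler0n R 2)) hM; apply: sum_le_mono => g pg.
  have [_ u2] := uB g h H pg hH H0 Hr.
  rewrite (uE _ _ pg) exprMn invfM nrmM mulrC ler_wpM2r ?nrm_ge0//.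
  by rewrite -exprVn nrmX lerXn2r ?nnegrE ?nrm_ge0// nrm1D_inv.
have [T' hT'] := has_sum_exists sm'.
rewrite (eisenstein_csum sm').2 (eisenstein_csum sm).2 (has_sum_csum hT) (has_sum_csum hT').
have hL := has_sum_sum (index_enum 'I_(dim0 n)) (fun i => - k%:R * h i 0) hD.
have hR := has_sum_lin (-1) (has_sum_lin 1 hT hL) hT'.
set L := \sum_(i <- _) _ in hL hR.
have -> : 2^-1 * T' - 2^-1 * T - \sum_i 2^-1 * (- k%:R * D i) * h i 0 = 2^-1 * (-1 * (1 * T + L) + T').
  rewrite (_ : \sum_i _ = 2^-1 * L); first by ring.
  by rewrite /L mulr_sumr; apply: eq_bigr => i _; ring.
have n2 : nrm (2^-1 : C) <= 1.
  by rewrite nrmV nrm_nat invf_le1// ler1n.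
rewrite nrmM; apply: (@le_trans _ _ (1 * nrm (-1 * (1 * T + L) + T'))); first by rewrite ler_wpM2r ?nrm_ge0.
rewrite mul1r; apply: has_sum_le hR.
have BH0 : 0 <= B * H ^+ 2.
  by rewrite mulr_ge0 ?sqr_ge0// addr_ge0// ?mulr_ge0// ?sqr_ge0// mulr_ge0.
have := sum_leZ BH0 hM; rewrite mulrAC; apply: sum_le_mono => g pg.
have [uA u2] := uB g h H pg hH H0 Hr.
(* After J^-k is factored out there remain the second-order remainder in u and a correction, because
   the derivative sees only the linear part of u. *)
have -> : -1 * (1 * J g ^- k + \sum_(i <- index_enum 'I_(dim0 n)) - k%:R * h i 0 * (a g i / J g ^+ k.+1)) +
    jvec S g (h + z) ^- k =
  (((1 + u g h) ^- k - 1 + k%:R * u g h) + k%:R * (gm g * Q0 S h / J g)) * J g ^- k.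
  rewrite (uE _ _ pg) exprMn invfM.
  rewrite (_ : \sum_(i <- _) _ = - k%:R * (\sum_i a g i * h i 0) / J g * J g ^- k); last first.
    rewrite mulr_sumr !mulr_suml; apply: eq_bigr => i _.
    by rewrite exprS invfM; ring.
  move: ((1 + u g h) ^- k) => e1; rewrite /u; move: (J g ^- k) (\sum_i _) => e2 e3.
  by rewrite !mulNr; ring.
rewrite nrmM ler_wpM2r ?nrm_ge0//; apply: le_trans (nrmD _ _) _.
rewrite /B mulrDl lerD//.
  apply: le_trans (hCk _ u2) _; rewrite -mulrA ler_wpM2l// -exprMn.
  by rewrite lerXn2r ?nnegrE ?nrm_ge0// mulr_ge0.
have Jp : 0 < nrm (J g) by rewrite lt_neqAle eq_sym nrm_eq0 J0// nrm_ge0.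
rewrite nrmM nrm_nat.
rewrite -[leRHS]mulrA ler_wpM2l// nrmM nrmV ler_pdivrMr// nrmM.
apply: (@le_trans _ _ (K * nrm (J g) * (q * H ^+ 2))).
  by apply: ler_pM; rewrite ?nrm_ge0 ?gmB ?qB.
by rewrite le_eqVlt; apply/orP; left; apply/eqP; ring.
Qed.

End Eisenstein.

Theorem theorem9 (R : realType) (n : nat) (hn : (0 < n)%N) (S : 'M[int]_n)
    (hS : even_posdef R S) (c0 : 'cV[rat]_n) (hc0 : dual_lattice S c0)
    (hQ : qform (inF rat S) c0 \is a Num.int) (k : nat) (hk : (n + 2 < k)%N) :
  (forall z : 'cV[R[i]]_(dim0 n), half_space S z ->
     [/\ abs_summable (cosets R S c0) (eis_term S c0 k z),
         abs_summable (prim_isotropic S c0) (fun g => jvec S g z ^- k)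
       & eisenstein R S c0 k z =
         2^-1 * csum (prim_isotropic S c0) (fun g => jvec S g z ^- k)]) /\
  modular_form S k (disc_kernel R S) (eisenstein R S c0 k).
Proof.
have [v _ vE] := hc0.
have Sc0 : inF rat S *m c0 = inF rat v by rewrite -vE mulKVmx// (S_unit hS).
have Qc0E : qform (inF rat S) c0 = (Num.floor (qform (inF rat S) c0))%:~R by rewrite floorK.
split=> [z hz|].
  have sm := prim_summable hS Sc0 Qc0E hk hz.
  have [sc E] := eisenstein_csum hS Sc0 Qc0E sm; split => //.
split; first exact: (eisenstein_holomorphic hS Sc0 Qc0E hk).
by move=> M gM z hz; exact: (eisenstein_modular hS Sc0 Qc0E hk hz gM).
Qed.
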